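(* Let $\mathbb K$ be an algebraically closed field of characteristic $0$. Let $V,V'\subset\mathbb K[\mathbf x]$ be vector spaces connected to $1$, and let $\sigma$ be a linear form on $\langle V\cdot V'\rangle$. Let $U\subset V$ and $U'\subset V'$ be vector subspaces such that $1\in U$, $U^+\subset V$ and $U'^+\subset V'$. Suppose $$\operatorname{rank}H^{V,V'}_\sigma=\operatorname{rank}H^{U,U'}_\sigma=r.$$ Then there is a unique $\tilde\sigma\in\mathbb K[[\mathbf y]]$ which coincides with $\sigma$ on $\langle V\cdot V'\rangle$ and satisfies $\operatorname{rank}H_{\tilde\sigma}=r$. Moreover: - $\tilde\sigma=\sum_{i=1}^{r'}\omega_i(\mathbf y)\mathbf e_{\xi_i}(\mathbf y)$ with $\omega_i\in\mathbb K[\mathbf y]$, $\xi_i\in\mathbb K^n$ and $r=\sum_{i=1}^{r'}\mu(\omega_i)$; - $I_{\tilde\sigma}$ is the ideal generated by $\ker H^{U^+,U'}_\sigma$.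
   Context: $\mathbb K[[\mathbf y]]$ is identified with the dual of $\mathbb K[\mathbf x]$ via $\langle\mathbf y^\alpha\mid\mathbf x^\beta\rangle=\alpha!\,\delta_{\alpha\beta}$. For $p\in\mathbb K[\mathbf x]$, $p\star\sigma$ is defined by $\langle p\star\sigma\mid q\rangle=\langle\sigma\mid pq\rangle$. $H_\sigma:p\mapsto p\star\sigma$ and $I_\sigma=\ker H_\sigma$. $\mathbf e_\xi(\mathbf y)=\exp(\sum_j\xi_jy_j)$. For $\omega\in\mathbb K[\mathbf y]$, $\mu(\omega)$ is the dimension of the span of $\omega$ and all its partial derivatives. For a vector space $V\subset\mathbb K[\mathbf x]$, $V^+=V+x_1V+\dots+x_nV$. The space $V$ is connected to $1$ if there is a finite chain of vector spaces $V_0\subset V_1\subset\dots\subset V_s=V$ with $V_0=\langle1\rangle$ and $V_{l+1}\subset V_l^+$. $\langle V\cdot V'\rangle$ is the span of the products $vv'$ with $v\in V$, $v'\in V'$. For vector spaces $W\subset V$, $W'\subset V'$ and a linear form $\sigma$ on $\langle V\cdot V'\rangle$, the truncated Hankel operator is $H^{W,W'}_\sigma:W\to W'^*$, $p\mapsto(w'\mapsto\langle\sigma\mid pw'\rangle)$. *)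

(* Defs.v *)
From Stdlib Require Import ClassicalEpsilon.
From HB Require Import structures.
From mathcomp Require Import all_boot all_order all_algebra.

Set Implicit Arguments.
Unset Strict Implicit.
Unset Printing Implicit Defensive.

Import Order.TTheory GRing.Theory Num.Theory.
Local Open Scope ring_scope.

Definition mono (n : nat) := {ffun 'I_n -> nat}.

(* coefficient functions: a polynomial of K[x] (sum_a f a x^a) or a formal
   power series of K[[y]] (sum_a f a y^a) *)
Definition ser (K : fieldType) (n : nat) := mono n -> K.

Section Defs.
Variables (K : fieldType) (n : nat).
Local Notation ser := (ser K n).
Local Notation mono := (mono n).

Definition mzero : mono := [ffun => 0%N].
Definition munit (j : 'I_n) : mono := [ffun i => nat_of_bool (i == j)].
Definition madd (a b : mono) : mono := [ffun i => (a i + b i)%N].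
Definition msub (a b : mono) : mono := [ffun i => (a i - b i)%N].
Definition mle (a b : mono) : bool := [forall i, a i <= b i]%N.
Definition mmax (a : mono) : nat := (\max_(i < n) a i)%N.
Definition mfact (a : mono) : nat := (\prod_(i < n) (a i)`!)%N.

Definition box (d : nat) : seq mono :=
  [seq [ffun i => nat_of_ord (a i)] | a : {ffun 'I_n -> 'I_d.+1}].

Definition is_poly (f : ser) : Prop :=
  exists d : nat, forall m, f m != 0 -> m \in box d.

Definition pone : ser := fun m => (m == mzero)%:R.
Definition xvar (j : 'I_n) : ser := fun m => (m == munit j)%:R.

Definition smul (f g : ser) : ser :=
  fun c => \sum_(a <- box (mmax c) | mle a c) f a * g (msub c a).

Definition pderiv (j : 'I_n) (f : ser) : ser :=
  fun m => ((m j).+1)%:R * f (madd m (munit j)).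

(* exponential e_xi(y) = exp(sum_j xi_j y_j) = sum_a xi^a / a! y^a *)
Definition expo (xi : 'rV[K]_n) : ser :=
  fun a => \prod_(i < n) (xi 0 i ^+ a i / ((a i)`!)%:R).

(* duality <y^a | x^b> = a! delta_{ab}: <tau | p> = sum_a tau_a a! p_a,
   the sum taken over a box containing the (finite) support of p *)
Definition pbound (p : ser) : nat :=
  epsilon (inhabits 0%N) (fun d => forall m, p m != 0 -> m \in box d).
Definition dual (tau p : ser) : K :=
  \sum_(m <- box (pbound p)) tau m * (mfact m)%:R * p m.

Definition lspan (S : ser -> Prop) (f : ser) : Prop :=
  exists k (a : 'I_k -> K) (g : 'I_k -> ser),
    (forall i, S (g i)) /\ f = (fun m => \sum_(i < k) a i * g i m).

Definition subspace (V : ser -> Prop) : Prop :=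
  [/\ V (fun _ => 0),
      (forall p q, V p -> V q -> V (fun m => p m + q m)),
      (forall a p, V p -> V (fun m => a * p m))
    & (forall p, V p -> is_poly p)].

Definition incl (A B : ser -> Prop) : Prop := forall f, A f -> B f.

Definition vplus (V : ser -> Prop) : ser -> Prop :=
  lspan (fun f => V f \/ exists j v, V v /\ f = smul (xvar j) v).

Definition prodspan (V V' : ser -> Prop) : ser -> Prop :=
  lspan (fun f => exists v v', [/\ V v, V' v' & f = smul v v']).

Definition connected (V : ser -> Prop) : Prop :=
  exists (s : nat) (C : nat -> ser -> Prop),
    [/\ (forall l, subspace (C l)),
        (forall f, C 0%N f <-> lspan (fun g => g = pone) f),
        (forall l f, (l < s)%N -> C l f -> C l.+1 f),
        (forall l f, (l < s)%N -> C l.+1 f -> vplus (C l) f)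
      & (forall f, C s f <-> V f)].

Definition lin_on (sigma : ser -> K) (S : ser -> Prop) : Prop :=
  forall a p q, S p -> S q ->
    sigma (fun m => a * p m + q m) = a * sigma p + sigma q.

(* the images H(w_i) : W' -> K, p |-> (w' |-> sigma (p w')), are linearly
   independent in W'^* *)
Definition himg_free (sigma : ser -> K) (W' : ser -> Prop) k (w : 'I_k -> ser)
  : Prop :=
  forall a : 'I_k -> K,
    (forall w', W' w' -> \sum_(i < k) a i * sigma (smul (w i) w') = 0) ->
    forall i, a i = 0.

Definition hrank (sigma : ser -> K) (W W' : ser -> Prop) (r : nat) : Prop :=
  (exists w : 'I_r -> ser, (forall i, W (w i)) /\ himg_free sigma W' w) /\
  (forall w : 'I_r.+1 -> ser, (forall i, W (w i)) -> ~ himg_free sigma W' w).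

Definition lfree k (g : 'I_k -> ser) : Prop :=
  forall a : 'I_k -> K,
    (fun m => \sum_(i < k) a i * g i m) = (fun _ => 0) -> forall i, a i = 0.

Definition vdim (S : ser -> Prop) (r : nat) : Prop :=
  (exists g : 'I_r -> ser, (forall i, lspan S (g i)) /\ lfree g) /\
  (forall g : 'I_r.+1 -> ser, (forall i, lspan S (g i)) -> ~ lfree g).

Definition derivs (om : ser) : ser -> Prop :=
  fun g => exists js : seq 'I_n, g = foldr pderiv om js.

Definition mu_eq (om : ser) (r : nat) : Prop := vdim (derivs om) r.

Definition kerH (sigma : ser -> K) (W W' : ser -> Prop) : ser -> Prop :=
  fun p => W p /\ forall w', W' w' -> sigma (smul p w') = 0.

Definition Iker (tau : ser) : ser -> Prop :=
  fun p => is_poly p /\ forall q, is_poly q -> dual tau (smul p q) = 0.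

Definition ideal_gen (S : ser -> Prop) : ser -> Prop :=
  fun f => exists k (q g : 'I_k -> ser),
    [/\ (forall i, is_poly (q i)), (forall i, S (g i))
      & f = (fun m => \sum_(i < k) smul (q i) (g i) m)].

End Defs.

(* Main.v *)
(* Choose w_1, ..., w_r in U whose images in U'^* form a basis of the image of
   H^{U,U'}.  Equality of the ranks gives V = <w_1, ..., w_r> + ker H^{V,V'},
   so every v in V has coordinates crd v : 'rV_r modulo that kernel.
   Multiplying w_i by x_j and reducing gives matrices M_j; they commute because
   sigma (M_i M_j b u) = sigma (x_j b x_i u) for u in U', and H^{V,U'} separates
   the coordinates.  Going up the chains that connect V and V' to 1, one gets
   crd v = e v(M) for v in V and (sigma (w_i v'))_i = v'(M) l for v' in V', with
   e = crd 1 and l = (sigma w_i)_i; hence sigma p = e p(M) l on <V.V'>, and the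
   same formula for all p defines the extension.  The vector e is cyclic and l
   is cocyclic for the M_j, which yields the rank; every p is congruent to its
   reduction modulo the ideal generated by ker H^{U^+,U'}, which yields the
   ideal and the uniqueness.  Finally the joint generalised eigenspaces E_i of
   the M_j, with eigenvalues xi_i, split the functional into summands
   omega_i e_{xi_i} with omega_i = sum_a e_i (M - xi_i)^a l y^a / a!; the
   derivatives of omega_i are obtained by replacing e_i by its images under the
   M_j - xi_ij, so they span a space isomorphic to E_i. *)
Require Import Defs.
From Stdlib Require Import Classical ClassicalEpsilon FunctionalExtensionality.
From HB Require Import structures.
From mathcomp Require Import all_boot all_order all_algebra.
From mathcomp Require Import ring.

Set Implicit Arguments.
Unset Strict Implicit.
Unset Printing Implicit Defensive.

Import GRing.Theory.
Local Open Scope ring_scope.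

(** * Multiplication of coefficient functions *)

(** Dropping the zero terms leaves two duplicate-free lists with the same members. This is what
    makes sums over boxes independent of the size of the box. *)
Lemma eq_big_supp (V : nmodType) (I : eqType) (s t : seq I) (F : I -> V) :
  uniq s -> uniq t ->
  (forall i, F i != 0 -> (i \in s) = (i \in t)) ->
  \sum_(i <- s) F i = \sum_(i <- t) F i.
Proof.
move=> us ut st.
have filt (u : seq I) : \sum_(i <- u) F i = \sum_(i <- u | F i != 0) F i.
  rewrite [RHS]big_mkcond; apply: eq_bigr => i _.
  by case: eqVneq.
rewrite filt [RHS]filt -big_filter -[RHS]big_filter.
apply/perm_big/uniq_perm; rewrite ?filter_uniq // => i.
rewrite !mem_filter; case: (eqVneq (F i) 0) => //= Fi; exact: st.
Qed.

(** * Exponent vectors and boxes *)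

Section Monomials.
Variable n : nat.
Implicit Types a b c : mono n.

Lemma leq_mmax a i : (a i <= mmax a)%N.
Proof. exact: (@leq_bigmax _ (fun i => a i)). Qed.

Lemma mmax_leP a d : reflect (forall i, a i <= d)%N (mmax a <= d)%N.
Proof.
apply: (iffP idP) => [le_ad i | le_ad]; first exact: leq_trans (leq_mmax a i) _.
by apply/bigmax_leqP => i _.
Qed.

Lemma mleP a b : reflect (forall i, a i <= b i)%N (mle a b).
Proof. exact: forallP. Qed.

Definition ffun_mono d (a : {ffun 'I_n -> 'I_d.+1}) : mono n :=
  [ffun i => nat_of_ord (a i)].

Lemma ffun_mono_inj d : injective (@ffun_mono d).
Proof.
by move=> a b /ffunP eab; apply/ffunP=> i; apply: val_inj; move: (eab i); rewrite !ffunE.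
Qed.

Lemma box_uniq d : uniq (box n d).
Proof. by rewrite map_inj_uniq ?enum_uniq //; apply: ffun_mono_inj. Qed.

Lemma mem_box d a : (a \in box n d) = (mmax a <= d)%N.
Proof.
apply/imageP/mmax_leP => [[u _ ->] i | le_ad].
  by rewrite ffunE -ltnS.
exists [ffun i => inord (a i)] => //; apply/ffunP=> i.
by rewrite !ffunE inordK // ltnS.
Qed.

Lemma big_box (V : nmodType) d (F : mono n -> V) :
  \sum_(a <- box n d) F a = \sum_(u : {ffun 'I_n -> 'I_d.+1}) F (ffun_mono u).
Proof. by rewrite big_image. Qed.

Lemma maddC a b : madd a b = madd b a.
Proof. by apply/ffunP=> i; rewrite !ffunE addnC. Qed.

Lemma mle_addr a b : mle a (madd a b).
Proof. by apply/mleP=> i; rewrite ffunE leq_addr. Qed.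

Lemma madd_msub a c : mle a c -> madd a (msub c a) = c.
Proof. by move=> /mleP ac; apply/ffunP=> i; rewrite !ffunE subnKC. Qed.

Lemma msub_madd a b : msub (madd a b) a = b.
Proof. by apply/ffunP=> i; rewrite !ffunE addKn. Qed.

Lemma mmax_mle a b : mle a b -> (mmax a <= mmax b)%N.
Proof. by move=> /mleP ab; apply/mmax_leP=> i; apply: leq_trans (leq_mmax b i). Qed.

Lemma mmax_madd a b : (mmax (madd a b) <= mmax a + mmax b)%N.
Proof. by apply/mmax_leP => i; rewrite ffunE leq_add ?leq_mmax. Qed.

(** Induction on the total degree: a nonzero exponent has a positive entry [j], and subtracting
    [munit j] lowers the degree. *)
Lemma mono_ind (P : mono n -> Prop) :
  P (mzero n) -> (forall j a, P a -> P (madd a (munit j))) -> forall a, P a.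
Proof.
move=> P0 PS a; move: {2}(\sum_i a i)%N (leqnn (\sum_i a i)) => k.
elim: k a => [|k IHk] a le_ak.
  suff -> : a = mzero n by [].
  apply/ffunP=> i; rewrite ffunE; apply/eqP; rewrite -leqn0.
  by apply: leq_trans le_ak; rewrite (bigD1 i) //= leq_addr.
case: (pickP (fun i => 0 < a i)%N) => [j aj | a0].
  have mj : mle (munit j) a.
    by apply/mleP=> i; rewrite ffunE; case: eqVneq => [->|].
  rewrite -(madd_msub mj) maddC; apply: PS; apply: IHk.
  rewrite -ltnS; apply: leq_trans le_ak.
  rewrite (bigD1 j) //= [X in (_ < X)%N](bigD1 j) //=.
  rewrite -addSn leq_add //; first by rewrite !ffunE eqxx subn1 prednK.
  by apply: leq_sum => i _; rewrite ffunE leq_subr.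
suff -> : a = mzero n by [].
by apply/ffunP=> i; rewrite ffunE; move: (a0 i); case: (a i).
Qed.

End Monomials.

(** * Convolution product, linear spans and polynomials *)

Section Series.
Variables (K : fieldType) (n : nat).
Local Notation ser := (ser K n).
Local Notation is_poly := (@is_poly K n).
Implicit Types (f g h p q : ser) (a b c m : mono n).

Lemma smul_box d f g c : (mmax c <= d)%N ->
  smul f g c = \sum_(a <- box n d | mle a c) f a * g (msub c a).
Proof.
move=> le_cd; rewrite /smul big_mkcond [RHS]big_mkcond.
apply: eq_big_supp; rewrite ?box_uniq // => a.
case: ifP => [/mmax_mle ac _|]; last by rewrite eqxx.
by rewrite !mem_box ac (leq_trans ac).
Qed.

(** A form symmetric in the two factors, over a fixed box: commutativity, bounds on supports and
    multiplicativity of evaluation are read off from it. *)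
Lemma smulE d f g c : (mmax c <= d)%N ->
  smul f g c = \sum_(a <- box n d) \sum_(b <- box n d)
                 (madd a b == c)%:R * (f a * g b).
Proof.
move=> le_cd; rewrite (smul_box _ _ le_cd) big_mkcond.
apply: eq_bigr => a _; case: ifP => ac; last first.
  rewrite big1 // => b _; case: eqP => [ec|]; last by rewrite mul0r.
  by rewrite -ec mle_addr in ac.
rewrite [RHS](bigD1_seq (msub c a)) ?box_uniq //=; last first.
  rewrite mem_box (leq_trans _ le_cd) //.
  by apply/mmax_mle/mleP=> i; rewrite ffunE leq_subr.
rewrite madd_msub // eqxx mul1r big1 ?addr0 // => b nb.
case: eqP => [ec|]; last by rewrite mul0r.
by rewrite -ec msub_madd eqxx in nb.
Qed.

Lemma smulC f g : smul f g = smul g f.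
Proof.
apply: functional_extensionality => c.
rewrite !(@smulE (mmax c)) // exchange_big /=.
apply: eq_bigr => a _; apply: eq_bigr => b _.
by rewrite maddC (mulrC (f b)).
Qed.

Lemma mle_msub a b c : mle a c && mle b (msub c a) = mle (madd a b) c.
Proof.
apply/andP/mleP => [[/mleP ac /mleP bc] i | abc].
  by move: (ac i) (bc i); rewrite !ffunE => aci; rewrite leq_subRL.
have ac i : (a i <= c i)%N.
  by apply: leq_trans (abc i); rewrite ffunE leq_addr.
split; apply/mleP => i //.
by move: (abc i); rewrite !ffunE leq_subRL.
Qed.

(** Both sides are sums over the pairs [a], [b] with [a + b <= c], and this condition is symmetric.
    Together with commutativity it gives associativity. *)
Lemma smulCA f g h : smul f (smul g h) = smul g (smul f h).
Proof.
have expand (f' g' : ser) c : smul f' (smul g' h) c =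
    \sum_(a <- box n (mmax c)) \sum_(b <- box n (mmax c))
      if mle (madd a b) c then f' a * g' b * h (msub (msub c a) b) else 0.
  rewrite (smul_box _ _ (leqnn _)) big_mkcond.
  apply: eq_bigr => a _; case: ifP => ac; last first.
    by rewrite big1 // => b _; rewrite -mle_msub ac.
  rewrite (@smul_box (mmax c)); last first.
    by apply/mmax_mle/mleP=> i; rewrite ffunE leq_subr.
  rewrite mulr_sumr big_mkcond; apply: eq_bigr => b _.
  by rewrite -mle_msub ac mulrA.
apply: functional_extensionality => c; rewrite !expand exchange_big /=.
apply: eq_bigr => a _; apply: eq_bigr => b _.
rewrite maddC (mulrC (f b)).
suff -> : msub (msub c b) a = msub (msub c a) b by [].
by apply/ffunP=> i; rewrite !ffunE subnAC.
Qed.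

Lemma smulA f g h : smul f (smul g h) = smul (smul f g) h.
Proof. by rewrite (smulC g) smulCA smulC. Qed.

Lemma smul_sumr k (x : 'I_k -> K) (g : 'I_k -> ser) f :
  smul f (fun m => \sum_(i < k) x i * g i m) =
  (fun m => \sum_(i < k) x i * smul f (g i) m).
Proof.
apply: functional_extensionality => c; rewrite /smul.
under eq_bigr do rewrite mulr_sumr.
rewrite exchange_big /=; apply: eq_bigr => i _.
by rewrite mulr_sumr; apply: eq_bigr => a _; rewrite mulrCA.
Qed.

Lemma smulDr x f p q :
  smul f (fun m => x * p m + q m) = (fun m => x * smul f p m + smul f q m).
Proof.
apply: functional_extensionality => c; rewrite /smul mulr_sumr -big_split /=.
by apply: eq_bigr => a _; rewrite mulrDr mulrCA.
Qed.

Lemma smul0r f : smul f (fun _ => 0) = (fun _ => 0).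
Proof. by apply: functional_extensionality => c; apply: big1 => a _; rewrite mulr0. Qed.

Definition monom a : ser := fun m => (m == a)%:R.

Lemma monom_smul a b : smul (monom a) (monom b) = monom (madd a b).
Proof.
apply: functional_extensionality => c.
pose d := maxn (mmax c) (maxn (mmax a) (mmax b)).
have [ad bd] : (mmax a <= d /\ mmax b <= d)%N.
  by rewrite !leq_max !leqnn !orbT.
rewrite (@smulE d) ?leq_maxl // /monom.
rewrite (bigD1_seq a) ?box_uniq ?mem_box //= [X in _ + X]big1 ?addr0; last first.
  by move=> i /negPf ia; rewrite big1 // => b' _; rewrite ia mul0r mulr0.
rewrite (bigD1_seq b) ?box_uniq ?mem_box //= [X in _ + X]big1 ?addr0; last first.
  by move=> i /negPf ib; rewrite ib !mulr0.
by rewrite !eqxx !mulr1 eq_sym.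
Qed.

Lemma smul1r f : smul (@pone K n) f = f.
Proof.
apply: functional_extensionality => c.
rewrite (smul_box _ _ (leqnn _)) big_mkcond.
rewrite (bigD1_seq (mzero n)) ?box_uniq //=; last first.
  by rewrite mem_box; apply/mmax_leP=> i; rewrite ffunE.
have -> : mle (mzero n) c by apply/mleP=> i; rewrite ffunE.
rewrite /pone eqxx mul1r big1 ?addr0.
  by congr f; apply/ffunP=> i; rewrite !ffunE subn0.
by move=> a /negPf ->; rewrite mul0r if_same.
Qed.

(** Unlike [subspace] it asks for no finite support, so it also serves as the condition on induction
    predicates over spans, polynomials and chains. *)
Definition lin_closed (S : ser -> Prop) : Prop :=
  S (fun _ => 0) /\ forall x p q, S p -> S q -> S (fun m => x * p m + q m).

Lemma lin_closed_sum (S : ser -> Prop) k (x : 'I_k -> K) (g : 'I_k -> ser) :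
  lin_closed S -> (forall i, S (g i)) -> S (fun m => \sum_(i < k) x i * g i m).
Proof.
case=> S0 SD; elim: k x g => [|k IHk] x g Sg.
  suff -> : (fun m => \sum_(i < 0) x i * g i m) = (fun _ => 0) by [].
  by apply: functional_extensionality => m; rewrite big_ord0.
set h := fun m => _.
suff -> : h = (fun m => x ord0 * g ord0 m +
    (fun m => \sum_(i < k) x (lift ord0 i) * g (lift ord0 i) m) m).
  by apply: SD => //; apply: IHk.
by apply: functional_extensionality => m; rewrite /h big_ord_recl.
Qed.

Lemma lin_closed_sum_seq (S : ser -> Prop) (I : Type) (s : seq I) (x : I -> K)
    (g : I -> ser) :
  lin_closed S -> (forall i, S (g i)) ->
  S (fun m => \sum_(i <- s) x i * g i m).
Proof.
case=> S0 SD Sg; elim: s => [|i s IHs].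
  suff -> : (fun m => \sum_(i <- [::]) x i * g i m) = (fun _ => 0) by [].
  by apply: functional_extensionality => m; rewrite big_nil.
suff -> : (fun m => \sum_(j <- i :: s) x j * g j m) =
    (fun m => x i * g i m + (fun m => \sum_(j <- s) x j * g j m) m) by apply: SD.
by apply: functional_extensionality => m; rewrite big_cons.
Qed.

Lemma lin_closedZ (S : ser -> Prop) x p :
  lin_closed S -> S p -> S (fun m => x * p m).
Proof.
case=> S0 SD Sp.
suff -> : (fun m => x * p m) = (fun m => x * p m + (fun _ => 0) m) by apply: SD.
by apply: functional_extensionality => m; rewrite addr0.
Qed.

Lemma lspan_lin_closed (S : ser -> Prop) : lin_closed (lspan S).
Proof.
split.
  exists 0%N, (fun _ => 0), (fun _ _ => 0); split=> [[]//|].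
  by apply: functional_extensionality => m; rewrite big_ord0.
move=> x _ _ [k [a [g [Sg ->]]]] [l [b [h [Sh ->]]]].
exists (k + l)%N, (fun i => match split i with inl i => x * a i | inr i => b i end),
  (fun i => match split i with inl i => g i | inr i => h i end); split.
  by move=> i; case: (split i).
apply: functional_extensionality => m; rewrite big_split_ord /= mulr_sumr.
congr (_ + _); apply: eq_bigr => i _; last by rewrite (unsplitK (inr i)).
by rewrite (unsplitK (inl i)) mulrA.
Qed.

Lemma lspan_gen (S : ser -> Prop) f : S f -> lspan S f.
Proof.
move=> Sf; exists 1%N, (fun _ => 1), (fun _ => f); split=> //.
by apply: functional_extensionality => m; rewrite big_ord1 mul1r.
Qed.

Lemma lspan_min (S T : ser -> Prop) f :
  lin_closed T -> (forall g, S g -> T g) -> lspan S f -> T f.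
Proof.
by move=> linT ST [k [a [g [Sg ->]]]]; apply: lin_closed_sum => // i; apply: ST.
Qed.

Lemma is_polyP p :
  is_poly p <-> exists d, forall m, p m != 0 -> (mmax m <= d)%N.
Proof. by split=> -[d pd]; exists d => m /pd; rewrite mem_box. Qed.

Lemma is_poly_lin_closed : lin_closed is_poly.
Proof.
split; first by exists 0%N => m; rewrite eqxx.
move=> x p q /is_polyP[d pd] /is_polyP[e qe]; apply/is_polyP; exists (maxn d e) => m.
have [p0|/pd le_md _] := eqVneq (p m) 0; last by rewrite leq_max le_md.
rewrite p0 mulr0 add0r => /qe le_me.
by rewrite leq_max le_me orbT.
Qed.

Lemma is_poly_monom a : is_poly (monom a).
Proof.
apply/is_polyP; exists (mmax a) => m; rewrite /monom.
by case: (m =P a) => [->|]; rewrite // eqxx.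
Qed.

Lemma smul_supp p q d e :
  (forall m, p m != 0 -> (mmax m <= d)%N) ->
  (forall m, q m != 0 -> (mmax m <= e)%N) ->
  forall m, smul p q m != 0 -> (mmax m <= d + e)%N.
Proof.
move=> pd qe m; apply: contraNT => gt_m.
rewrite (smulE _ _ (leqnn _)) big1 // => a _; rewrite big1 // => b _.
case: eqP => [em|]; last by rewrite mul0r.
have [->|/pd ad] := eqVneq (p a) 0; first by rewrite mul0r mulr0.
have [->|/qe be] := eqVneq (q b) 0; first by rewrite !mulr0.
by case/negP: gt_m; rewrite -em (leq_trans (mmax_madd a b)) ?leq_add.
Qed.

Lemma is_poly_smul p q : is_poly p -> is_poly q -> is_poly (smul p q).
Proof.
move=> /is_polyP[d pd] /is_polyP[e qe]; apply/is_polyP; exists (d + e)%N.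
exact: smul_supp.
Qed.

Lemma ser_box_monom p d : (forall m, p m != 0 -> (mmax m <= d)%N) ->
  p = (fun m => \sum_(a <- box n d) p a * monom a m).
Proof.
move=> pd; apply: functional_extensionality => m; rewrite /monom.
have [md|md] := boolP (m \in box n d).
  rewrite (bigD1_seq m) ?box_uniq //= eqxx mulr1 big1 ?addr0 // => a /negPf am.
  by rewrite eq_sym am mulr0.
rewrite big1_seq => [|a /= ad]; last first.
  by case: eqP => [ma|]; [rewrite ma ad in md | rewrite mulr0].
by apply/eqP; apply: contraNT md => /pd; rewrite mem_box.
Qed.

(** Linearity reduces the claim to monomials, which are reached from 1 by multiplying by one
    variable at a time. *)
Lemma is_poly_ind (P : ser -> Prop) :
  lin_closed P -> P (@pone K n) ->
  (forall j p, is_poly p -> P p -> P (smul (@xvar K n j) p)) ->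
  forall p, is_poly p -> P p.
Proof.
move=> linP P1 PX p /is_polyP[d /ser_box_monom ->].
apply: lin_closed_sum_seq => // a; elim/mono_ind: a => [|j a Pa]; first exact: P1.
by rewrite maddC -monom_smul; apply: PX => //; apply: is_poly_monom.
Qed.

End Series.

(** * Linear forms and evaluation at commuting matrices *)

Section Forms.
Variables (K : fieldType) (n : nat).
Local Notation ser := (ser K n).
Local Notation is_poly := (@is_poly K n).
Implicit Types (p q : ser) (sigma : ser -> K) (tau : ser).

(** The value of [pbound] comes from a choice operator and is unknown; any box that contains the
    support gives the same sum. *)
Lemma big_poly_supp (V : nmodType) (F : mono n -> V) p d :
  is_poly p -> (forall m, p m != 0 -> (mmax m <= d)%N) ->
  (forall m, p m = 0 -> F m = 0) ->
  \sum_(m <- box n (pbound p)) F m = \sum_(m <- box n d) F m.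
Proof.
move=> pp pd F0; apply: eq_big_supp; rewrite ?box_uniq // => m Fm.
have pm : p m != 0 by apply: contraNneq Fm => /F0 ->.
by rewrite [RHS]mem_box (pd _ pm); apply: (epsilon_spec (inhabits 0%N) _ pp).
Qed.

Lemma lin_on_sum sigma (S : ser -> Prop) k (x : 'I_k -> K) (g : 'I_k -> ser) :
  lin_closed S -> lin_on sigma S -> (forall i, S (g i)) ->
  sigma (fun m => \sum_(i < k) x i * g i m) = \sum_(i < k) x i * sigma (g i).
Proof.
move=> linS sigS.
have sig0 : sigma (fun _ => 0) = 0.
  (* Linearity with coefficient -1 at the zero series gives [sigma 0 = - sigma 0 + sigma 0]. *)
  have := sigS (-1) _ _ linS.1 linS.1; set z := (X in sigma X = _).
  have -> : z = (fun _ => 0).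
    by apply: functional_extensionality => m; rewrite /z mulr0 addr0.
  by move=> ->; rewrite mulN1r addNr.
elim: k x g => [|k IHk] x g Sg.
  rewrite big_ord0 -sig0; congr sigma.
  by apply: functional_extensionality => m; rewrite big_ord0.
rewrite big_ord_recl -(IHk (fun i => x (lift ord0 i)) (fun i => g (lift ord0 i))) //.
rewrite -sigS //; last exact: lin_closed_sum.
by congr sigma; apply: functional_extensionality => m; rewrite big_ord_recl.
Qed.

Lemma dualE tau p d : is_poly p -> (forall m, p m != 0 -> (mmax m <= d)%N) ->
  dual tau p = \sum_(m <- box n d) tau m * (mfact m)%:R * p m.
Proof. by move=> pp pd; apply: big_poly_supp => // m ->; rewrite mulr0. Qed.

Lemma supp2 p q : is_poly p -> is_poly q ->
  exists d, (forall m, p m != 0 -> (mmax m <= d)%N) /\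
            (forall m, q m != 0 -> (mmax m <= d)%N).
Proof.
move=> /is_polyP[d pd] /is_polyP[e qe]; exists (maxn d e).
by split=> m; [move=> /pd | move=> /qe]; rewrite leq_max => ->; rewrite ?orbT.
Qed.

Lemma suppD p q x d : (forall m, p m != 0 -> (mmax m <= d)%N) ->
  (forall m, q m != 0 -> (mmax m <= d)%N) ->
  forall m, x * p m + q m != 0 -> (mmax m <= d)%N.
Proof.
move=> pd qd m; have [-> /=|/pd //] := eqVneq (p m) 0.
by rewrite mulr0 add0r => /qd.
Qed.

Lemma dual_lin tau : lin_on (dual tau) is_poly.
Proof.
move=> x p q pp pq; have [d [pd qd]] := supp2 pp pq.
rewrite (dualE tau _ (suppD pd qd)); last exact: (is_poly_lin_closed _ _).2.
rewrite (dualE _ pp pd) (dualE _ pq qd) mulr_sumr -big_split /=.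
by apply: eq_bigr => m _; rewrite mulrDr mulrCA.
Qed.

Lemma dual_monom tau a : dual tau (monom K a) = tau a * (mfact a)%:R.
Proof.
rewrite (@dualE _ _ (mmax a)); first last.
- by move=> m; rewrite /monom; case: (m =P a) => [->|]; rewrite // eqxx.
- exact: is_poly_monom.
rewrite (bigD1_seq a) ?box_uniq ?mem_box //= /monom eqxx mulr1 big1 ?addr0 //.
by move=> m /negPf ->; rewrite mulr0.
Qed.

Lemma mfact_neq0 (a : mono n) : [pchar K] =i pred0 -> (mfact a)%:R != 0 :> K.
Proof.
move=> /pcharf0P ->; rewrite -lt0n prodn_gt0 // => i.
exact: fact_gt0.
Qed.

End Forms.

(** * Evaluation of polynomials at a family of matrices *)

Section Evaluation.
Variables (K : fieldType) (n r : nat) (M : 'I_n -> 'M[K]_r).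
Local Notation ser := (ser K n).
Local Notation is_poly := (@is_poly K n).
Implicit Types (p q : ser).

(** The factors are taken in the order of the indices, so the definition makes sense before the
    matrices are known to commute. *)
Definition mpow (a : mono n) : 'M[K]_r := \prod_(j < n) M j ^+ a j.

Definition ev p : 'M[K]_r := \sum_(m <- box n (pbound p)) p m *: mpow m.

Lemma evE p d : is_poly p -> (forall m, p m != 0 -> (mmax m <= d)%N) ->
  ev p = \sum_(m <- box n d) p m *: mpow m.
Proof. by move=> pp pd; apply: big_poly_supp => // m ->; rewrite scale0r. Qed.

Lemma ev_lin x p q : is_poly p -> is_poly q ->
  ev (fun m => x * p m + q m) = x *: ev p + ev q.
Proof.
move=> pp pq; have [d [pd qd]] := supp2 pp pq.
rewrite (evE _ (suppD pd qd)); last exact: (is_poly_lin_closed _ _).2.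
rewrite (evE pp pd) (evE pq qd) scaler_sumr -big_split /=.
by apply: eq_bigr => m _; rewrite scalerDl scalerA.
Qed.

Lemma ev0 : ev (fun _ => 0) = 0.
Proof. by apply: big1 => a _; rewrite scale0r. Qed.

Lemma ev_sum k (x : 'I_k -> K) (g : 'I_k -> ser) :
  (forall i, is_poly (g i)) ->
  ev (fun m => \sum_(i < k) x i * g i m) = \sum_(i < k) x i *: ev (g i).
Proof.
elim: k x g => [|k IHk] x g pg.
  rewrite big_ord0 -ev0; congr ev.
  by apply: functional_extensionality => m; rewrite big_ord0.
rewrite big_ord_recl -(IHk (fun i => x (lift ord0 i)) (fun i => g (lift ord0 i))) //.
rewrite -ev_lin //; last by apply: lin_closed_sum => //; apply: is_poly_lin_closed.
by congr ev; apply: functional_extensionality => m; rewrite big_ord_recl.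
Qed.

Lemma ev_monom a : ev (monom K a) = mpow a.
Proof.
rewrite (@evE _ (mmax a)); first last.
- by move=> m; rewrite /monom; case: (m =P a) => [->|]; rewrite // eqxx.
- exact: is_poly_monom.
rewrite (bigD1_seq a) ?box_uniq ?mem_box //= /monom eqxx scale1r big1 ?addr0 //.
by move=> m /negPf ->; rewrite scale0r.
Qed.

Lemma mpow0 : mpow (mzero n) = 1.
Proof. by apply: big1 => j _; rewrite ffunE expr0. Qed.

Lemma ev1 : ev (@pone K n) = 1.
Proof. by rewrite (ev_monom (mzero n)) mpow0. Qed.

Lemma mpow_unit j : mpow (munit j) = M j.
Proof.
rewrite -[RHS](big_pred1_eq *%R j M) [RHS]big_mkcond.
by apply: eq_bigr => i _; rewrite ffunE; case: ifP.
Qed.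

Lemma commr_ev X p : (forall j, GRing.comm X (M j)) -> GRing.comm X (ev p).
Proof.
move=> cX; rewrite /GRing.comm mulr_sumr mulr_suml; apply: eq_bigr => m _.
rewrite -!mulmxE -scalemxAr -scalemxAl; congr (_ *: _).
by apply: commr_prod => j _; apply/commrX/cX.
Qed.

Hypothesis commM : forall i j, M i * M j = M j * M i.

Lemma mpowD a b : mpow (madd a b) = mpow a * mpow b.
Proof.
rewrite -prodrM_comm => [|i j _ _]; last exact/commrX/commr_sym/commrX/commr_sym/commM.
by apply: eq_bigr => j _; rewrite ffunE exprD.
Qed.

Lemma ev_smul p q : is_poly p -> is_poly q -> ev (smul p q) = ev p * ev q.
Proof.
move=> pp pq; have [d [pd qd]] := supp2 pp pq.
rewrite (evE _ (smul_supp pd qd)); last exact: is_poly_smul.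
rewrite (evE pp pd) (evE pq qd).
(* Both factors live in the box of size [d], their product in that of size [d + d]; all sums are
   brought to the larger box, which contains every [a + b]. *)
have ext (V : nmodType) (F : mono n -> V) (f : ser) :
    (forall m, f m != 0 -> (mmax m <= d)%N) -> (forall m, f m = 0 -> F m = 0) ->
    \sum_(m <- box n d) F m = \sum_(m <- box n (d + d)) F m.
  move=> fd F0; apply: eq_big_supp; rewrite ?box_uniq // => m Fm.
  have fm : f m != 0 by apply: contraNneq Fm => /F0 ->.
  by rewrite !mem_box (fd _ fm) (leq_trans (fd _ fm) (leq_addr _ _)).
under eq_big_seq => c.
  rewrite mem_box => cd; rewrite (smulE _ _ cd) scaler_suml.
  under eq_bigr do rewrite scaler_suml.
  over.
rewrite exchange_big /=.
rewrite (ext _ _ p) //; last by move=> m ->; rewrite scale0r.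
rewrite (ext _ (fun m => q m *: mpow m) q) //; last by move=> m ->; rewrite scale0r.
rewrite mulr_suml; apply: eq_bigr => a _.
rewrite exchange_big mulr_sumr /=; apply: eq_bigr => b _.
have [->|/pd ad] := eqVneq (p a) 0.
  by rewrite scale0r [RHS]mul0r big1 // => c _; rewrite mul0r mulr0 scale0r.
have [->|/qd bd] := eqVneq (q b) 0.
  by rewrite scale0r [RHS]mulr0 big1 // => c _; rewrite !mulr0 scale0r.
have abd : madd a b \in box n (d + d).
  by rewrite mem_box (leq_trans (mmax_madd a b)) ?leq_add.
rewrite (bigD1_seq (madd a b)) ?box_uniq //= eqxx mul1r big1 ?addr0.
  by rewrite mpowD -!mulmxE -scalemxAl -scalemxAr scalerA.
by move=> c /negPf; rewrite eq_sym => ->; rewrite mul0r scale0r.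
Qed.

Lemma ev_xvar j p : is_poly p -> ev (smul (@xvar K n j) p) = M j * ev p.
Proof.
by move=> pp; rewrite ev_smul ?(ev_monom (munit j)) ?mpow_unit //; apply: is_poly_monom.
Qed.

(** The division by [m!] cancels the factorial in the duality, so that this series pairs with [p] to
    [e p(M) l]. *)
Definition moment (e : 'rV[K]_r) (l : 'cV[K]_r) : ser :=
  fun m => (e *m mpow m *m l) 0 0 / (mfact m)%:R.

Lemma dual_moment e l p : [pchar K] =i pred0 -> is_poly p ->
  dual (moment e l) p = (e *m ev p *m l) 0 0.
Proof.
move=> charK pp; rewrite mulmx_sumr mulmx_suml summxE.
apply: eq_bigr => m _; rewrite /moment divfK ?mfact_neq0 //.
by rewrite -scalemxAr -scalemxAl [RHS]mxE mulrC.
Qed.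

End Evaluation.

(** * Joint spectral projectors *)

Section Idempotents.
Variable K : fieldType.

Lemma coprimep_prodr (I : eqType) (t : seq I) (f : I -> {poly K}) p :
  {in t, forall i, coprimep p (f i)} -> coprimep p (\prod_(i <- t) f i).
Proof.
move=> cop; rewrite big_seq; elim/big_rec: _ => [|i q it IH]; first exact: coprimep1.
by rewrite coprimepMr cop.
Qed.

Lemma dvdp_prod_coprime (I : eqType) (t : seq I) (f : I -> {poly K}) p :
  uniq t -> {in t &, forall i j, i != j -> coprimep (f i) (f j)} ->
  {in t, forall i, f i %| p} -> \prod_(i <- t) f i %| p.
Proof.
elim: t => [|i t IHt] /= => [_ _ _|/andP[it ut] cop dvd].
  by rewrite big_nil dvd1p.
rewrite big_cons Gauss_dvdp.
  rewrite dvd ?mem_head // IHt // => [j k jt kt|j jt].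
    by apply: cop; rewrite inE ?jt ?kt orbT.
  by apply: dvd; rewrite inE jt orbT.
apply: coprimep_prodr => j jt; apply: cop; rewrite ?mem_head ?inE ?jt ?orbT //.
by apply: contraNneq it => ->.
Qed.

(** Chinese remaindering: [q a] is a multiple of the product [g a] of the other factors, corrected
    by a Bezout coefficient so as to be 1 modulo [('X - a)^N]. These are orthogonal idempotents
    modulo [F]. *)
Lemma poly_idempotents (s : seq K) N : uniq s ->
  let F := \prod_(a <- s) ('X - a%:P) ^+ N in
  exists q : K -> {poly K},
    [/\ F %| 1 - \sum_(a <- s) q a,
        {in s, forall a, F %| ('X - a%:P) ^+ N * q a}
      & {in s &, forall a b, a != b -> F %| q a * q b}].
Proof.
move=> us F; pose f a : {poly K} := ('X - a%:P) ^+ N.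
pose g a := \prod_(b <- s | b != a) f b.
have Ffg a : a \in s -> F = f a * g a by move=> sa; rewrite /F (bigD1_seq a).
have cop a b : a != b -> coprimep (f a) (f b).
  move=> ab; apply/coprimep_expl/coprimep_expr.
  by rewrite coprimep_XsubC root_XsubC eq_sym.
have copg a : coprimep (f a) (g a).
  rewrite /g -big_filter; apply: coprimep_prodr => b.
  by rewrite mem_filter eq_sym => /andP[/cop].
have bez a : exists v, f a %| 1 - v * g a.
  have /Bezout_eq1_coprimepP[[u v] /= uv1] := copg a.
  by exists v; rewrite -uv1 addrK dvdp_mull.
pose v a := proj1_sig (constructive_indefinite_description _ (bez a)).
have vP a : f a %| 1 - v a * g a.
  exact: (proj2_sig (constructive_indefinite_description _ (bez a))).
have fg a b : a \in s -> a != b -> f a %| g b.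
  by move=> sa ab; rewrite /g -big_filter (big_rem a) ?mem_filter ?ab //= dvdp_mulr.
exists (fun a => v a * g a); split.
- apply: dvdp_prod_coprime => // [a b _ _ /cop //|a sa].
  rewrite (bigD1_seq a) //= opprD addrA; apply: dvdp_sub; first exact: vP.
  rewrite big_mkcond; elim/big_rec: _ => [|b p _ fp]; rewrite ?dvdp0 //.
  by case: ifP => [ab|_]; rewrite ?add0r // dvdp_add // dvdp_mull // fg // eq_sym.
- by move=> a sa; rewrite (Ffg a) // mulrCA dvdp_mull.
move=> a b sa sb ab; rewrite (Ffg a) // mulrACA dvdp_mull // mulrC dvdp_mul //.
by rewrite fg.
Qed.

End Idempotents.

Lemma prod_mul_eq0 (R : pzRingType) (I : eqType) (s : seq I) (F : I -> R) x j :
  j \in s -> F j * x = 0 -> (forall i, GRing.comm x (F i)) ->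
  (\prod_(i <- s) F i) * x = 0.
Proof.
move=> sj Fx cx; elim: s sj => [//|i s IHs]; rewrite inE big_cons -mulrA.
case: eqP => [<- _ | _ /IHs ->]; last by rewrite mulr0.
by rewrite -(commr_prod s (fun i _ => cx i)) mulrA Fx mul0r.
Qed.

Lemma mul_prod_eq0 (R : pzRingType) (I : eqType) (s : seq I) (F : I -> R) x j :
  j \in s -> x * F j = 0 -> (forall i, GRing.comm x (F i)) ->
  x * (\prod_(i <- s) F i) = 0.
Proof.
move=> sj Fx cx; rewrite (commr_prod s (fun i _ => cx i)).
by apply: (prod_mul_eq0 sj) => //; rewrite -cx.
Qed.

(** The polynomial idempotents evaluated at each [M j] project onto its generalised eigenspaces.
    Products over [j], one eigenvalue being chosen for each [j], project onto the joint ones. *)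
Lemma joint_idempotents (K : closedFieldType) (n r : nat) (M : 'I_n -> 'M[K]_r) :
  (forall i j, M i * M j = M j * M i) ->
  exists (I : finType) (P : I -> 'M[K]_r) (xi : I -> 'rV[K]_n) (N : nat),
    [/\ \sum_i P i = 1,
        forall i j, i != j -> P i * P j = 0,
        forall i j, P i * M j = M j * P i
      & forall i j, (M j - (xi i 0 j)%:M) ^+ N * P i = 0].
Proof.
(* In size zero all matrices coincide and the empty family works. *)
case: r M => [|r] M commM.
  exists void, (fun _ => 0), (fun _ => 0), 0%N.
  by split; [rewrite flatmx0 [RHS]flatmx0| case | case | case].
have [t tP] : exists t : 'I_n -> seq K, forall j,
    char_poly (M j) = \prod_(z <- t j) ('X - z%:P).
  exists (fun j => sval (closed_field_poly_normal (char_poly (M j)))) => j.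
  case: closed_field_poly_normal => u /= {1}->.
  by rewrite (monicP (char_poly_monic _)) scale1r.
have size_t j : size (t j) = r.+1.
  have := size_char_poly (M j); rewrite tP size_prod_XsubC; by case.
(* One list holds the eigenvalues of all the [M j], so that the same polynomials [q] serve every
   [j]. *)
pose s := undup (flatten [seq t j | j <- enum 'I_n]).
have ts j z : z \in t j -> z \in s.
  move=> zt; rewrite mem_undup; apply/flattenP; exists (t j) => //.
  by apply: map_f; rewrite mem_enum.
have [q []] := @poly_idempotents K s r.+1 (undup_uniq _).
set F := \prod_(a <- s) _ => q1 qN q0.
(* The characteristic polynomial has [r.+1] linear factors with roots in [s], so it divides [F],
   where each root has multiplicity [r.+1]; Cayley-Hamilton concludes. *)
have F0 j p : F %| p -> horner_mx (M j) p = 0.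
  move=> /dvdpP[u ->]; rewrite rmorphM /=.
  suff /dvdpP[w ->] : char_poly (M j) %| F.
    by rewrite rmorphM /= Cayley_Hamilton !mulr0.
  rewrite tP /F prodrXl -(size_t j).
  have : {subset t j <= s} by move=> z; apply: ts.
  elim: (t j) => [|z t' IHt] us; first by rewrite big_nil dvd1p.
  rewrite big_cons exprS dvdp_mul //; last first.
    by apply: IHt => a ta; apply: us; rewrite inE ta orbT.
  by rewrite (big_rem z) ?dvdp_mulr // us ?mem_head.
pose Q j a := horner_mx (M j) (q a).
have commQ j a i : GRing.comm (Q j a) (M i).
  exact/comm_horner_mx/commM.
have commQQ j a i b : GRing.comm (Q j a) (Q i b).
  exact/comm_mx_horner/commQ.
pose I := {ffun 'I_n -> 'I_(size s)}.
(* A choice [c] that is not a joint eigenvalue yields the zero projector, which is kept in the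
   family. *)
exists I, (fun c : I => \prod_j Q j s`_(c j)),
  (fun c : I => \row_j s`_(c j)), r.+1; split.
(* The sum over all choices factors as a product over [j] of sums of idempotents, each equal to
   1. *)
- rewrite -(bigA_distr_bigA (fun j (a : 'I_(size s)) => Q j (s`_a))) big1 // => j _.
  have /F0 := q1 => /(_ j); rewrite rmorphB rmorph1 rmorph_sum /= => /eqP.
  rewrite subr_eq0 => /eqP ->.
  by rewrite (big_nth 0) big_mkord.
- move=> c d cd.
  have [j cdj] : exists j, c j != d j.
    by apply/existsP; apply: contraNT cd; rewrite negb_exists => /forallP cd;
      apply/eqP/ffunP=> j; apply/eqP; move: (cd j); rewrite negbK.
  apply: (@mul_prod_eq0 _ _ _ _ _ j); rewrite ?mem_index_enum //; last first.
    by move=> i; apply: commr_sym; apply: commr_prod => k _; apply: commQQ.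
  apply: (@prod_mul_eq0 _ _ _ _ _ j); rewrite ?mem_index_enum //.
  have qcd : F %| q s`_(c j) * q s`_(d j).
    by apply: q0; rewrite ?mem_nth // nth_uniq ?undup_uniq.
  by have := F0 j _ qcd; rewrite rmorphM.
- by move=> c j; apply/commr_sym/commr_prod => i _; apply/commr_sym/commQ.
move=> c j; apply: (@mul_prod_eq0 _ _ _ _ _ j); rewrite ?mem_index_enum //.
  have qc : F %| ('X - (s`_(c j))%:P) ^+ r.+1 * q s`_(c j) by rewrite qN ?mem_nth.
  have := F0 j _ qc.
  by rewrite rmorphM rmorphXn rmorphB /= horner_mx_X horner_mx_C mxE.
move=> i; apply: commr_sym; apply: commrX; apply: commrB; first exact: commQ.
exact: scalar_mxC.
Qed.

(** * Decomposition of moment functionals *)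

Lemma row_dependence (K : fieldType) k r (C : 'M[K]_(k, r)) :
  (\rank C < k)%N -> exists2 a : 'rV[K]_k, a != 0 & a *m C = 0.
Proof.
move=> rkC; have : kermx C != 0 by rewrite kermx_eq0 /row_free neq_ltn rkC.
by move/rowV0Pn => [a /sub_kermxP aC0 nza]; exists a.
Qed.

(** Orthogonality and sum 1 force [P i * P i = P i]. A vector of the row space of [P i] is then
    fixed by [P i] but killed if it lies in the sum of the others, so the row spaces form a direct
    sum, which is everything. *)
Lemma rank_idempotents (K : fieldType) r (I : finType) (P : I -> 'M[K]_r) :
  \sum_i P i = 1 -> (forall i j, i != j -> P i * P j = 0) ->
  (\sum_i \rank (P i))%N = r.
Proof.
move=> P1 P0.
have PP i : P i * P i = P i.
  rewrite -[RHS]mulr1 -P1 mulr_sumr (bigD1 i) //= big1 ?addr0 // => j ji.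
  by rewrite P0 // eq_sym.
have /mxdirectP /= <- : mxdirect (\sum_i P i)%MS.
  apply/mxdirect_sumsP => i _; apply/eqP/rowV0P => v.
  rewrite sub_capmx => /andP[/submxP[u ->]] /sub_sumsmxP[w uw].
  transitivity ((u *m P i) *m P i); first by rewrite -mulmxA [P i *m P i]PP.
  rewrite uw mulmx_suml big1 // => j /andP[_ ji].
  by rewrite -mulmxA [P j *m P i]P0 // mulmx0.
apply/eqP; rewrite -[_ == _]/(row_full _) -sub1mx -[1%:M]P1.
by apply: summx_sub_sums => i _.
Qed.

Lemma prod_scalemx (K : fieldType) r (I : Type) (s : seq I) (x : I -> K)
    (A : I -> 'M[K]_r) :
  \prod_(i <- s) (x i *: A i) = (\prod_(i <- s) x i) *: \prod_(i <- s) A i.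
Proof.
elim: s => [|i s IHs]; first by rewrite !big_nil scale1r.
by rewrite !big_cons IHs -!mulmxE -scalemxAl -scalemxAr scalerA.
Qed.

Lemma scalar_mxX (K : fieldType) r (x : K) k : (x%:M : 'M_r) ^+ k = (x ^+ k)%:M.
Proof. by elim: k => [//|k IHk]; rewrite !exprS IHk -mulmxE -scalar_mxM. Qed.

(** * Moment series: linearity, derivatives, exponential factors *)

Section Moments.
Variables (K : fieldType) (n r : nat).
Hypothesis charK : [pchar K] =i pred0.
Implicit Types (A : 'I_n -> 'M[K]_r) (u v : 'rV[K]_r) (l : 'cV[K]_r).

Lemma moment_mulmx A l k (a : 'rV[K]_k) (C : 'M_(k, r)) :
  moment A (a *m C) l = (fun m => \sum_i a 0 i * moment A (row i C) l m).
Proof.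
apply: functional_extensionality => m; rewrite /moment (mulmx_sum_row a C).
rewrite 2!mulmx_suml summxE mulr_suml; apply: eq_bigr => i _.
by rewrite -!scalemxAl mxE mulrA.
Qed.

Lemma moment_lin A l x u v :
  moment A (x *: u + v) l = (fun m => x * moment A u l m + moment A v l m).
Proof.
apply: functional_extensionality => m.
by rewrite /moment 2!mulmxDl -!scalemxAl mxE [X in (X + _) / _]mxE mulrDl mulrA.
Qed.

Lemma moment0 A l : moment A 0 l = (fun _ => 0).
Proof.
by apply: functional_extensionality => m; rewrite /moment !mul0mx mxE mul0r.
Qed.

Lemma moment_sum A l (I : finType) (u : I -> 'rV[K]_r) :
  moment A (\sum_i u i) l = (fun m => \sum_i moment A (u i) l m).
Proof.
apply: functional_extensionality => m; rewrite /moment 2!mulmx_suml summxE.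
by rewrite mulr_suml.
Qed.

Lemma moment_eq0 A u l : moment A u l = (fun _ => 0) ->
  forall m, u *m mpow A m *m l = 0.
Proof.
move=> mom0 m; have := congr1 (fun f => f m) mom0; rewrite /moment => /eqP.
rewrite mulf_eq0 invr_eq0 (negPf (mfact_neq0 _ charK)) orbF => /eqP um0.
by apply/matrixP=> i j; rewrite !ord1 um0 mxE.
Qed.

Lemma mfact_munit (m : mono n) j : mfact (madd m (munit j)) = ((m j).+1 * mfact m)%N.
Proof.
rewrite /mfact (bigD1 j) // [in RHS](bigD1 j) //= !ffunE eqxx addn1 factS mulnA.
congr (_ * _)%N; apply: eq_bigr => i /negPf ij.
by rewrite !ffunE ij addn0.
Qed.

(** The factor [m j + 1] from the derivative turns the factorial of the raised exponent back into
    [m!]; the extra [A j] is absorbed by the row. Derivatives thus become the action of the matrices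
    on rows. *)
Lemma pderiv_moment A u l j : (forall i k, A i * A k = A k * A i) ->
  pderiv j (moment A u l) = moment A (u *m A j) l.
Proof.
move=> commA; apply: functional_extensionality => m.
rewrite /pderiv /moment mfact_munit maddC mpowD // mpow_unit -mulmxE mulmxA natrM.
have /pcharf0P natr_eq0 := charK.
by rewrite mulrCA; congr (_ * _); rewrite invfM mulrA divff ?mul1r // natr_eq0.
Qed.

Lemma mpow_shift A (xi : 'rV[K]_n) (c : mono n) :
  mpow (fun j => A j + (xi 0 j)%:M) c =
  \sum_(a <- box n (mmax c))
    (\prod_j (xi 0 j ^+ (c j - a j) *+ 'C(c j, a j))) *: mpow A a.
Proof.
rewrite big_box /mpow.
have expand j : (A j + (xi 0 j)%:M) ^+ c j =
    \sum_(k < (mmax c).+1) (xi 0 j ^+ (c j - k) *+ 'C(c j, k)) *: A j ^+ k.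
  rewrite addrC exprDn_comm; last exact/commr_sym/scalar_mxC.
  (* The binomial sum is extended from [c j] to [mmax c], the added coefficients being zero, so that
     all coordinates share one range and the product distributes over functions. *)
  rewrite (big_ord_widen (mmax c).+1
    (fun k => (xi 0 j)%:M ^+ (c j - k) * A j ^+ k *+ 'C(c j, k)));
    last by rewrite ltnS leq_mmax.
  rewrite big_mkcond; apply: eq_bigr => k _; rewrite ltnS.
  case: leqP => kc; last by rewrite bin_small // mulr0n scale0r.
  by rewrite scalar_mxX -mulmxE mul_scalar_mx scalerMnl.
under eq_bigr do rewrite expand.
rewrite (bigA_distr_bigA (fun j (k : 'I_(mmax c).+1) =>
  (xi 0 j ^+ (c j - k) *+ 'C(c j, k)) *: A j ^+ k)).
apply: eq_bigr => f _; rewrite prod_scalemx; congr (_ *: _); apply: eq_bigr => j _;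
  by rewrite ffunE.
Qed.

(** The binomial theorem in every coordinate, with [C(c,a) / c! = 1 / (a! (c - a)!)]: multiplying by
    the exponential translates the matrices by [xi]. *)
Lemma smul_moment_expo A (xi : 'rV[K]_n) u l :
  smul (moment A u l) (expo xi) = moment (fun j => A j + (xi 0 j)%:M) u l.
Proof.
have /pcharf0P natr_eq0 := charK.
have fact_neq0 k : (k`!)%:R != 0 :> K by rewrite natr_eq0 -lt0n fact_gt0.
apply: functional_extensionality => c; rewrite /smul /moment mpow_shift.
rewrite mulmx_sumr mulmx_suml summxE mulr_suml big_mkcond; apply: eq_bigr => a _.
rewrite -scalemxAr -scalemxAl [X in _ = X / _]mxE.
case: ifP => [/mleP ac|/negP ac].
  rewrite [X in X / _]mulrC -!mulrA; congr (_ * _).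
  rewrite /expo /mfact !natr_prod -!prodfV -!big_split /=; apply: eq_bigr => j _.
  rewrite ffunE -(bin_fact (ac j)) !natrM -mulr_natr.
  have bin0 : 'C(c j, a j)%:R != 0 :> K by rewrite natr_eq0 -lt0n bin_gt0.
  by field; rewrite bin0 !fact_neq0.
have [j] : exists j, ~~ (a j <= c j)%N.
  by apply/existsP; rewrite -negb_forall; apply/negP.
rewrite -ltnNge => caj; rewrite (bigD1 j) //= bin_small // mulr0n mul0r.
by rewrite mul0r mul0r.
Qed.

End Moments.









(** [Phi] is linear and maps the row space of [P] isomorphically onto the span of [S]. A row base
    gives a free family, and more rows than [\rank P] in that space satisfy a linear relation. *)
Lemma vdim_rowspace (K : fieldType) n r (S : ser K n -> Prop) (P : 'M[K]_r)
    (Phi : 'rV[K]_r -> ser K n) :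
  (forall k (a : 'rV_k) (C : 'M_(k, r)),
     Phi (a *m C) = (fun m => \sum_i a 0 i * Phi (row i C) m)) ->
  (forall v, Phi (v *m P) = (fun _ => 0) -> v *m P = 0) ->
  (forall g, lspan S g <-> exists v, g = Phi (v *m P)) ->
  vdim S (\rank P).
Proof.
move=> linPhi injPhi spanS; split.
  have /submxP[D defB] : (row_base P <= P)%MS by rewrite eq_row_base.
  exists (fun k => Phi (row k (row_base P))); split=> [k | a a0].
    by apply/spanS; exists (row k D); rewrite defB row_mul.
  pose u := \row_k a k; have uB0 : u *m row_base P = 0.
    rewrite defB mulmxA; apply: injPhi; rewrite -mulmxA -defB linPhi -[RHS]a0.
    by apply: functional_extensionality => m; apply: eq_bigr => k _; rewrite mxE.
  move/eqP: uB0; rewrite mulmx_free_eq0 ?row_base_free // => /eqP/rowP u0 k.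
  by have := u0 k; rewrite !mxE.
move=> g spang freeg.
have vP k : exists v, g k = Phi (v *m P) by apply/spanS.
pose v k := proj1_sig (constructive_indefinite_description _ (vP k)).
have gv k : g k = Phi (v k *m P).
  exact: (proj2_sig (constructive_indefinite_description _ (vP k))).
pose C := (\matrix_k v k) *m P.
have [|a nza aC] := @row_dependence K _ _ C; first by rewrite ltnS mxrankM_maxr.
case/eqP: nza; apply/rowP=> k; rewrite mxE; apply: (freeg (fun k => a 0 k)).
have Phi0 : Phi 0 = (fun _ => 0).
  rewrite -(mul0mx 1 (0 : 'M_(0, r))) linPhi.
  by apply: functional_extensionality => m; rewrite big_ord0.
rewrite -Phi0 -aC linPhi; apply: functional_extensionality => m.
by apply: eq_bigr => i _; rewrite gv /C row_mul rowK.
Qed.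

(** Inserting [1 = \sum_i P i] after [e] splits the series. The matrices [A i j] are nilpotent on
    the image of [P i], so [om i] is a polynomial. Cyclicity of [e] and cocyclicity of [l] identify
    the span of its derivatives with the row space of [P i]. A zero projector gives [om i = 0] with
    [mu = 0]. *)
Lemma moment_decomposition (K : closedFieldType) n r (M : 'I_n -> 'M[K]_r) e l :
  [pchar K] =i pred0 -> (forall i j, M i * M j = M j * M i) ->
  (forall v : 'rV_r, exists2 p : ser K n, is_poly p & v = e *m ev M p) ->
  (forall u : 'rV_r, (forall m, u *m mpow M m *m l = 0) -> u = 0) ->
  exists (r' : nat) (om : 'I_r' -> ser K n) (xi : 'I_r' -> 'rV[K]_n)
         (mu : 'I_r' -> nat),
    [/\ (forall i, is_poly (om i)),
        moment M e l = (fun m => \sum_(i < r') smul (om i) (expo (xi i)) m),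
        (forall i, mu_eq (om i) (mu i))
      & r = (\sum_(i < r') mu i)%N].
Proof.
move=> charK commM cyc cocyc.
have [I [P [xi [N [P1 P0 commP nilP]]]]] := joint_idempotents commM.
pose A i j := M j - (xi i 0 j)%:M.
have commA i j k : A i j * A i k = A i k * A i j.
  have commMA j' : GRing.comm (M j') (A i k).
    by apply: commrB; [apply: commM | apply: scalar_mxC].
  by apply/commr_sym/commrB; [apply/commr_sym/commMA | apply: scalar_mxC].
have commPA i j : P i * A i j = A i j * P i.
  by apply: commrB; [apply: commP | apply: scalar_mxC].
have MA i : (fun j => A i j + (xi i 0 j)%:M) = M.
  by apply: functional_extensionality => j; rewrite subrK.
have shift i u : smul (moment (A i) u l) (expo (xi i)) = moment M u l.
  by rewrite smul_moment_expo // MA.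
pose om i := moment (A i) (e *m P i) l.
have poly_om i : is_poly (om i).
  apply/is_polyP; exists N => m om_m; apply/mmax_leP => j.
  apply: contraNT om_m; rewrite -ltnNge => Nm.
  suff PA0 : P i * mpow (A i) m = 0.
    by rewrite /om /moment -(mulmxA e) [P i *m _]PA0 mulmx0 mul0mx mxE mul0r.
  apply: (@mul_prod_eq0 _ _ _ _ _ j); rewrite ?mem_index_enum //; last first.
    by move=> k; apply/commrX/commPA.
  rewrite (commrX _ (commPA i j)) -(subnK (ltnW Nm)) exprD -mulrA.
  by rewrite nilP mulr0.
have ev_comm i p : P i * ev M p = ev M p * P i by apply: commr_ev => j; apply: commP.
have pderiv_span i j f :
    lspan (derivs (om i)) f -> lspan (derivs (om i)) (pderiv j f).
  have [span0 spanD] := lspan_lin_closed (derivs (om i)).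
  apply: (@lspan_min _ _ _ (fun f => lspan (derivs (om i)) (pderiv j f))) => [|_ [js ->]];
    last by apply: lspan_gen; exists (j :: js).
  split=> [|x p q sp sq].
    suff -> : pderiv j (fun _ => 0) = (fun _ => 0) :> ser K n by [].
    by apply: functional_extensionality => m; rewrite /pderiv mulr0.
  suff -> : pderiv j (fun m => x * p m + q m) =
      (fun m => x * pderiv j p m + pderiv j q m) by apply: spanD.
  by apply: functional_extensionality => m; rewrite /pderiv mulrDr mulrCA.
have span_om i g : lspan (derivs (om i)) g <-> exists v, g = moment (A i) (v *m P i) l.
  split.
    apply: (@lspan_min _ _ _ (fun g => exists v, g = moment (A i) (v *m P i) l))
      => [|_ [js ->]].
      split; first by exists 0; rewrite mul0mx moment0.
      move=> x _ _ [u ->] [v ->]; exists (x *: u + v).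
      by rewrite mulmxDl -scalemxAl moment_lin.
    elim: js => [|j js [v IHjs]]; first by exists e.
    exists (v *m A i j); rewrite /= IHjs pderiv_moment //.
    by rewrite -!mulmxA [P i *m _]commPA.
  (* By cyclicity [v = e p(M)], which allows an induction on [p]; [Q] also records that the argument
     is a polynomial, as the rules for [ev] require. *)
  move=> [v ->]; have [p pp ->] := cyc v; rewrite -mulmxA -[_ *m P i]ev_comm.
  pose Q p := is_poly p /\ lspan (derivs (om i)) (moment (A i) (e *m (P i * ev M p)) l).
  suff [//] : Q p.
  have [span0 spanD] := lspan_lin_closed (derivs (om i)).
  have [poly0 polyD] := is_poly_lin_closed K n.
  apply: (@is_poly_ind _ _ Q _ _ _ _ pp).
  - split; first by split=> //; rewrite ev0 mulr0 mulmx0 moment0.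
    move=> x f h [pf sf] [ph sh]; split; first exact: polyD.
    rewrite ev_lin // mulrDr mulmxDr -[P i * (x *: _)]scalemxAr -scalemxAr moment_lin.
    exact: spanD.
  - split; first exact: (is_poly_monom K (mzero n)).
    by rewrite ev1 mulr1; apply: lspan_gen; exists [::].
  move=> j f pf [_ sf]; split.
    by apply: is_poly_smul => //; apply: (is_poly_monom K (munit j)).
  rewrite ev_xvar //.
  (* Since [M j] is the scalar [xi_ij] plus [A i j], multiplying by [x_j] acts on the series as a
     scalar plus the derivative in [y_j], under which the span is stable. *)
  have -> : e *m (P i * (M j * ev M f)) =
      xi i 0 j *: (e *m (P i * ev M f)) + e *m (P i * ev M f) *m A i j.
    have commX : GRing.comm (A i j) (P i * ev M f).
      apply: commrM; first exact/commr_sym/commPA.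
      by apply: commr_ev => k; apply/commr_sym/commrB; [apply: commM | apply: scalar_mxC].
    rewrite -mulmxA [_ *m A i j]commr_sym // mulrBl mulmxBr -[_%:M * _]/(_%:M *m _).
    by rewrite mul_scalar_mx -scalemxAr addrC subrK !mulrA commP.
  by rewrite moment_lin -pderiv_moment //; apply: spanD => //; apply: pderiv_span.
exists #|I|, (fun k => om (enum_val k)), (fun k => xi (enum_val k)),
  (fun k => \rank (P (enum_val k))); split=> //.
- rewrite -{1}[e]mulmx1 -[1%:M]P1 mulmx_sumr moment_sum.
  apply: functional_extensionality => m.
  rewrite (reindex (@enum_val I predT)) /=; last exact/onW_bij/enum_val_bij.
  by apply: eq_bigr => k _; rewrite shift.
- move=> k; set i := enum_val k; pose Phi v := moment (A i) v l.
  apply: (@vdim_rowspace _ _ _ _ _ Phi) (span_om i).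
    by move=> *; apply: moment_mulmx.
  (* Multiplying the zero series by the exponential turns moments for [A i] into moments for [M], to
     which cocyclicity applies. *)
  move=> v v0; apply: cocyc => m; apply: moment_eq0 => //.
  by rewrite -(shift i) [moment _ _ _]v0 smulC smul0r.
rewrite -[LHS](rank_idempotents P1 P0).
by rewrite (reindex (@enum_val I predT)) //=; apply/onW_bij/enum_val_bij.
Qed.

(** * Connected spaces, ranks and ideals *)

Section Spans.
Variables (K : fieldType) (n : nat).
Local Notation ser := (ser K n).
Local Notation is_poly := (@is_poly K n).
Implicit Types (V U W : ser -> Prop) (p q f : ser).

Lemma vplus_sub U : incl U (vplus U).
Proof. by move=> u Uu; apply: lspan_gen; left. Qed.

Lemma vplus_xvar U j u : U u -> vplus U (smul (@xvar K n j) u).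
Proof. by move=> Uu; apply: lspan_gen; right; exists j, u. Qed.

Lemma prodspan_mul V V' v v' : V v -> V' v' -> prodspan V V' (smul v v').
Proof. by move=> Vv Vv'; apply: lspan_gen; exists v, v'. Qed.

Lemma prodspan_poly V V' p : subspace V -> subspace V' -> prodspan V V' p -> is_poly p.
Proof.
move=> [_ _ _ polyV] [_ _ _ polyV'].
apply: lspan_min => [|_ [v [v' [/polyV pv /polyV' pv' ->]]]]; last exact: is_poly_smul.
exact: is_poly_lin_closed.
Qed.

Lemma connected_pone V : connected V -> V (@pone K n).
Proof.
move=> [s [C [_ C0 Cinc _ Cs]]]; apply/Cs.
have : forall l, (l <= s)%N -> C l (@pone K n).
  elim=> [_|l IHl ls]; first by apply/C0/lspan_gen.
  by apply: Cinc => //; apply: IHl; apply: ltnW.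
exact.
Qed.

(* The multiples [x_j f] met along the chain need not lie in [V], only [f] does. *)
Lemma connected_ind V (Q : ser -> Prop) :
  connected V -> lin_closed Q -> Q (@pone K n) ->
  (forall j f, V f -> Q f -> Q (smul (@xvar K n j) f)) ->
  incl V Q.
Proof.
move=> [s [C [_ C0 Cinc Cplus Cs]]] linQ Q1 QX.
(* Induction on the number [d] of links left above level [l]: the whole chain lies in [V]. *)
have CV d : forall l, (l + d = s)%N -> incl (C l) V.
  elim: d => [|d IHd] l; first by rewrite addn0 => -> f /Cs.
  rewrite addnS => lds f /Cinc Clf; apply: (IHd l.+1); first by rewrite addSn.
  by apply: Clf; rewrite -lds ltnS leq_addr.
have CQ l : (l <= s)%N -> incl (C l) Q.
  elim: l => [_ f /C0|l IHl ls f /(Cplus _ _ ls)].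
    by apply: lspan_min => // _ ->.
  apply: lspan_min => // g [Cg|[j [v [Cv ->]]]]; first exact: IHl (ltnW ls) _ Cg.
  apply: QX; last exact: IHl (ltnW ls) _ Cv.
  by apply: (CV (s - l)%N l) => //; rewrite subnKC // ltnW.
by move=> f /Cs; apply: CQ.
Qed.

(** The [r + 1] elements [v, w_1, ..., w_r] are dependent against [W']. The [w_i] are already
    independent against the smaller [T'], so [v] has a nonzero coefficient and can be solved for on
    all of [W']. *)
Lemma hrank_coords (sigma : ser -> K) W W' T' r (w : 'I_r -> ser) :
  hrank sigma W W' r -> (forall i, W (w i)) -> incl T' W' -> himg_free sigma T' w ->
  forall v, W v -> exists c : 'rV[K]_r, forall w', W' w' ->
    sigma (smul v w') = \sum_i c 0 i * sigma (smul (w i) w').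
Proof.
move=> [_ maxr] Ww TW freew v Wv.
pose f (i : 'I_r.+1) := if unlift ord0 i is Some j then w j else v.
have /maxr : forall i, W (f i) by move=> i; rewrite /f; case: unlift.
rewrite /himg_free => notfree.
have [a nota] := not_all_ex_not _ _ notfree.
have [a0 /not_all_ex_not[i0 ai0]] := imply_to_and _ _ nota.
have rel w' : W' w' ->
    a ord0 * sigma (smul v w') + \sum_i a (lift ord0 i) * sigma (smul (w i) w') = 0.
  move=> /a0; rewrite big_ord_recl /f unlift_none => eq0.
  by rewrite -[RHS]eq0; congr (_ + _); apply: eq_bigr => i _; rewrite liftK.
have nz : a ord0 != 0.
  apply/eqP=> a00; apply: ai0.
  have al : forall i, a (lift ord0 i) = 0.
    by apply: freew => w' /TW /rel; rewrite a00 mul0r add0r.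
  by case: (unliftP ord0 i0) => [j ->|->].
exists (\row_i (- a (lift ord0 i) / a ord0)) => w' /rel /eqP.
rewrite addr_eq0 => /eqP eqa; apply: (mulfI nz); rewrite eqa mulr_sumr -sumrN.
apply: eq_bigr => i _; rewrite mxE; field.
exact: nz.
Qed.

Lemma ideal_gen_lin_closed (S : ser -> Prop) : lin_closed (ideal_gen S).
Proof.
split.
  exists 0%N, (fun _ _ => 0), (fun _ _ => 0); split=> [[]//|[]//|].
  by apply: functional_extensionality => m; rewrite big_ord0.
move=> x _ _ [k [a [g [pa Sg ->]]]] [l [b [h [pb Sh ->]]]].
have [poly0 polyD] := is_poly_lin_closed K n.
exists (k + l)%N,
  (fun i => match split i with inl i => (fun m => x * a i m) | inr i => b i end),
  (fun i => match split i with inl i => g i | inr i => h i end); split.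
- move=> i; case: (split i) => // j.
  by apply: lin_closedZ => //; apply: is_poly_lin_closed.
- by move=> i; case: (split i).
apply: functional_extensionality => m; rewrite big_split_ord /= mulr_sumr.
congr (_ + _); apply: eq_bigr => i _; last by rewrite (unsplitK (inr i)).
by rewrite (unsplitK (inl i)) mulr_sumr; apply: eq_bigr => c _; rewrite mulrA.
Qed.

Lemma ideal_gen_gen (S : ser -> Prop) f : S f -> ideal_gen S f.
Proof.
move=> Sf; exists 1%N, (fun _ => @pone K n), (fun _ => f); split=> // [i|].
  exact: (is_poly_monom K (mzero n)).
by apply: functional_extensionality => m; rewrite big_ord1 smul1r.
Qed.

Lemma ideal_gen_smul (S : ser -> Prop) p f :
  is_poly p -> ideal_gen S f -> ideal_gen S (smul p f).
Proof.
move=> pp [k [q [g [pq Sg ->]]]]; exists k, (fun i => smul p (q i)), g; split=> //.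
  by move=> i; apply: is_poly_smul.
have sum1 (h : 'I_k -> ser) :
    (fun m => \sum_(i < k) h i m) = (fun m => \sum_(i < k) 1 * h i m).
  by apply: functional_extensionality => m; under [RHS]eq_bigr do rewrite mul1r.
rewrite sum1 [RHS]sum1 smul_sumr; apply: functional_extensionality => m.
by apply: eq_bigr => i _; rewrite smulA.
Qed.

(** The kernel of a Hankel operator is an ideal, because a polynomial factor can be moved to the
    test polynomial. *)
Lemma Iker_ideal (S : ser -> Prop) tau p :
  incl S is_poly ->
  (forall g, S g -> Iker tau g) -> ideal_gen S p -> Iker tau p.
Proof.
move=> polyS SI [k [q [g [pq Sg ->]]]].
have linI : lin_closed (Iker tau).
  have [poly0 polyD] := is_poly_lin_closed K n.
  split=> [|x f h [pf If] [ph Ih]].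
    split=> // f pf; rewrite smulC smul0r.
    by apply: big1 => m _; rewrite mulr0.
  split=> [|f' pf']; first exact: polyD.
  rewrite smulC smulDr dual_lin; try exact: is_poly_smul.
  by rewrite !(smulC f') If // Ih // mulr0 addr0.
suff -> : (fun m => \sum_(i < k) smul (q i) (g i) m) =
    (fun m => \sum_(i < k) 1 * smul (q i) (g i) m).
  apply: lin_closed_sum => // i; have [pg Ig] := SI _ (Sg i).
  split=> [|f pf]; first exact: is_poly_smul.
  by rewrite (smulC (q i)) -smulA Ig //; apply: is_poly_smul.
by apply: functional_extensionality => m; apply: eq_bigr => i _; rewrite mul1r.
Qed.

End Spans.

(** * The flat extension *)

Section FlatExtension.
Variables (K : fieldType) (n r : nat).
Local Notation ser := (ser K n).
Local Notation is_poly := (@is_poly K n).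
Variables (V V' U U' : ser -> Prop) (sigma : ser -> K).
Hypotheses (charK : [pchar K] =i pred0).
Hypotheses (subV : subspace V) (subV' : subspace V').
Hypotheses (conV : connected V) (conV' : connected V').
Hypothesis (linsig : lin_on sigma (prodspan V V')).
Hypotheses (UV : incl U V) (UV' : incl U' V').
Hypothesis (U1 : U (@pone K n)).
Hypotheses (plusU : incl (vplus U) V) (plusU' : incl (vplus U') V').
Variable w : 'I_r -> ser.
Hypotheses (wU : forall i, U (w i)) (wfree : himg_free sigma U' w).
Variable crd : ser -> 'rV[K]_r.
Hypothesis crd_sum : forall v v', V v -> V' v' ->
  sigma (smul v v') = \sum_i crd v 0 i * sigma (smul (w i) v').

Local Notation X := (@xvar K n).
(** The counterpart of [crd] on the side of [V']: [sigma (v v')] is the product of the row [crd v]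
    with this column. *)
Definition pairing (v' : ser) : 'cV[K]_r := \col_i sigma (smul (w i) v').
Local Notation G := pairing.
(** Multiplication by [x_j] followed by reduction modulo the kernel, in the basis of the [w_i] and
    acting on rows from the right. *)
Definition mulop (j : 'I_n) : 'M[K]_r := \matrix_i crd (smul (X j) (w i)).
Local Notation M := mulop.
Local Notation e := (crd (@pone K n)).
Local Notation l := (G (@pone K n)).

Let polyX j : is_poly (X j). Proof. exact: (is_poly_monom K (munit j)). Qed.
Let poly1 : is_poly (@pone K n). Proof. exact: (is_poly_monom K (mzero n)). Qed.
Let polyV v : V v -> is_poly v. Proof. by case: subV => _ _ _; apply. Qed.
Let polyV' v : V' v -> is_poly v. Proof. by case: subV' => _ _ _; apply. Qed.
Let wV i : V (w i). Proof. exact/UV. Qed.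
Let XU j u : U u -> V (smul (X j) u). Proof. by move=> Uu; apply/plusU/vplus_xvar. Qed.
Let XU' j u : U' u -> V' (smul (X j) u).
Proof. by move=> Uu; apply/plusU'/vplus_xvar. Qed.
Let lin1 := lspan_lin_closed (fun f => exists v v', [/\ V v, V' v' & f = smul v v']).

Let sigma0 : sigma (fun=> 0) = 0.
Proof.
have -> : (fun=> 0) = (fun m => \sum_(i < 0) 0 * (fun=> 0) m) :> ser.
  by apply: functional_extensionality => m; rewrite big_ord0.
by rewrite (lin_on_sum _ lin1) // ?big_ord0 // => -[].
Qed.

(** * Coordinates and multiplication operators *)

Lemma crdE v v' : V v -> V' v' -> crd v *m G v' = (sigma (smul v v'))%:M.
Proof.
move=> Vv Vv'; apply/matrixP=> i j; rewrite !ord1 !mxE crd_sum //.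
by apply: eq_bigr => k _; rewrite mxE.
Qed.

(** The [w_i] are free against [U'], so testing on [U'] suffices; there a multiplication by a
    variable still leads into [V']. *)
Lemma crd_inj (a : 'rV[K]_r) : (forall u, U' u -> a *m G u = 0) -> a = 0.
Proof.
move=> a0; apply/rowP=> i; rewrite mxE; apply: (wfree (a := fun i => a 0 i)) => u Uu.
have := congr1 (fun A : 'M_1 => A 0 0) (a0 u Uu); rewrite !mxE => {2}<-.
by apply: eq_bigr => k _; rewrite mxE.
Qed.

Lemma crd_uniq v (a : 'rV[K]_r) : V v ->
  (forall u, U' u -> (sigma (smul v u))%:M = a *m G u) -> crd v = a.
Proof.
move=> Vv va; apply/eqP; rewrite -subr_eq0; apply/eqP/crd_inj => u Uu.
by rewrite mulmxBl crdE -?va ?subrr //; apply: UV'.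
Qed.

Lemma mulop_G j v' : V' v' -> M j *m G v' = \col_i sigma (smul (smul (X j) (w i)) v').
Proof.
move=> Vv'; apply/row_matrixP => i; rewrite row_mul rowK crdE //; last exact: XU.
by apply/rowP=> k; rewrite !ord1 !mxE.
Qed.

Lemma mulop_xvar j u : U' u -> M j *m G u = G (smul (X j) u).
Proof.
move=> Uu; rewrite mulop_G; last exact: UV'.
by apply/colP=> i; rewrite !mxE (smulC _ (w i)) smulA.
Qed.

(** One variable goes to each side: [x_i w_k] is in [V] and [x_j u] in [V'], so [sigma] is applied
    only inside the span of the products. *)
Lemma mulop_comm i j : M i * M j = M j * M i.
Proof.
apply/eqP; rewrite -subr_eq0; apply/eqP/row_matrixP => k; rewrite row0.
apply: crd_inj => u Uu; rewrite -row_mul mulmxBl -!mulmxE -!mulmxA !(mulop_xvar _ Uu).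
rewrite !mulop_G; try exact: XU'.
apply/rowP=> k'; rewrite !mxE.
by rewrite -!smulA (smulCA (w k)) (smulCA (w k) (X i)) (smulCA (X i)) subrr.
Qed.

(** The induction along the chain passes through multiples [x_j f] that may leave [V], where [crd]
    carries no information. The predicate [Q] therefore speaks of [sigma (f u)] for [u] in [U']; the
    variable is moved to [u], and for [f] in [V] the coordinates are recovered from [Q]. *)
Lemma crd_ev v : V v -> crd v = e *m ev M v.
Proof.
pose Q f := is_poly f /\ forall u, U' u -> prodspan V V' (smul f u) /\
  (sigma (smul f u))%:M = e *m ev M f *m G u.
have Qcrd f : V f -> Q f -> crd f = e *m ev M f.
  by move=> Vf [_ Qf]; apply: crd_uniq => // u /Qf[].
move=> Vv; apply: (Qcrd _ Vv); move: v Vv; apply: (connected_ind conV).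
- have [poly0 polyD] := is_poly_lin_closed K n; have [span0 spanD] := lin1.
  split=> [|x p q [pp Qp] [pq Qq]].
    split=> // u Uu; rewrite smulC smul0r ev0 mulmx0 mul0mx; split=> //.
    by rewrite sigma0 raddf0.
  split=> [|u Uu]; first exact: polyD.
  have [[sp ep] [sq eq]] := (Qp u Uu, Qq u Uu).
  rewrite smulC smulDr !(smulC u); split; first exact: spanD.
  rewrite linsig // ev_lin // mulmxDr mulmxDl -scalemxAr -scalemxAl -ep -eq.
  by rewrite scale_scalar_mx -raddfD.
- split=> // u Uu; split.
    by apply: prodspan_mul; [exact: connected_pone | exact: UV'].
  by rewrite ev1 mulmx1 crdE //; [apply: UV | apply: UV'].
move=> j f Vf Qf; have [pf Qfu] := Qf; split=> [|u Uu]; first exact: is_poly_smul.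
rewrite (smulC _ f) -smulA; split; first exact: prodspan_mul (XU' j Uu).
rewrite -crdE //; last exact: XU'.
rewrite (Qcrd _ Vf Qf) (smulC f) ev_xvar -?mulop_xvar //; last exact: mulop_comm.
have -> : M j * ev M f = ev M f * M j by apply: commr_ev => k; apply: mulop_comm.
by rewrite -mulmxE !mulmxA.
Qed.

(** The same induction on the side of [V'], with the variable moved to [w i]; [Q] also keeps
    [w i * f] in the span on which [sigma] is linear. *)
Lemma G_ev v' : V' v' -> G v' = ev M v' *m l.
Proof.
pose Q f := [/\ is_poly f, (forall i, prodspan V V' (smul (w i) f)) & G f = ev M f *m l].
have [poly0 polyD] := is_poly_lin_closed K n; have [span0 spanD] := lin1.
move: v'; suff : incl V' Q by move=> VQ v' /VQ[].
apply: (connected_ind conV').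
- split=> [|x p q [pp sp ep] [pq sq eq]].
    split=> // [i|]; first by rewrite smul0r.
    by rewrite ev0 mul0mx; apply/colP=> i; rewrite !mxE smul0r sigma0.
  split=> [|i|]; first exact: polyD.
    by rewrite smulDr; apply: spanD; [exact: sp | exact: sq].
  rewrite ev_lin // mulmxDl -scalemxAl -ep -eq; apply/colP=> i.
  by rewrite !mxE smulDr linsig.
- split=> // [i|]; last by rewrite ev1 mul1mx.
  by apply: prodspan_mul => //; apply: connected_pone.
move=> j f Vf [pf sf ef]; split=> [|i|]; first exact: is_poly_smul.
- by rewrite smulA; apply: prodspan_mul => //; rewrite smulC; apply: XU.
rewrite ev_xvar //; last exact: mulop_comm.
rewrite -mulmxE -mulmxA -ef mulop_G //; apply/colP=> i; rewrite !mxE.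
by rewrite smulA (smulC (w i)).
Qed.

(** * The extended series and its rank *)

Definition flat_ext : ser := moment M e l.
Local Notation tau := flat_ext.

Lemma dual_flat_ext p : is_poly p -> dual tau p = (e *m ev M p *m l) 0 0.
Proof. exact: dual_moment. Qed.

Lemma dual_flat_ext_smul p q : is_poly p -> is_poly q ->
  dual tau (smul p q) = (e *m ev M p *m (ev M q *m l)) 0 0.
Proof.
move=> pp pq; rewrite dual_flat_ext; last exact: is_poly_smul.
by rewrite ev_smul ?mulmxA //; apply: mulop_comm.
Qed.

Lemma flat_ext_agree p : prodspan V V' p -> dual tau p = sigma p.
Proof.
move=> [k [a [g [gen ->]]]].
have gs i : prodspan V V' (g i) by apply: lspan_gen.
rewrite (lin_on_sum _ lin1 linsig) //.
rewrite (lin_on_sum _ (is_poly_lin_closed K n) (@dual_lin _ _ tau)); last first.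
  by move=> i; apply: prodspan_poly (gs i).
apply: eq_bigr => i _; congr (_ * _); have [v [v' [Vv Vv' ->]]] := gen i.
rewrite dual_flat_ext_smul; [|exact: polyV|exact: polyV'].
by rewrite -crd_ev // -G_ev // crdE // mxE eqxx.
Qed.

(** The witness is [\sum_i a_i w_i], because [crd (w i)] is the i-th unit row. *)
Lemma cyclic_ev (a : 'rV[K]_r) : exists2 p, is_poly p & a = e *m ev M p.
Proof.
exists (fun m => \sum_i a 0 i * w i m).
  by apply: lin_closed_sum => [|i]; [exact: is_poly_lin_closed | exact: polyV].
rewrite ev_sum => [|i]; last exact: polyV.
rewrite mulmx_sumr [LHS]row_sum_delta; apply: eq_bigr => i _.
rewrite -scalemxAr -crd_ev //; congr (_ *: _); symmetry; apply: crd_uniq => // u Uu.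
apply/rowP=> k; by rewrite !ord1 -rowE !mxE.
Qed.

(** For [u] in [U'] the column [G u] is [u(M) l], so [a] kills every [G u], and [U'] separates
    rows. *)
Lemma cocyclic_mpow (a : 'rV[K]_r) : (forall m, a *m mpow M m *m l = 0) -> a = 0.
Proof.
move=> a0; apply: crd_inj => u Uu; rewrite G_ev; last exact: UV'.
rewrite mulmxA mulmx_sumr mulmx_suml big1 // => m _.
by rewrite -scalemxAr -scalemxAl a0 scaler0.
Qed.

Lemma Iker_ev p : Iker tau p -> e *m ev M p = 0.
Proof.
move=> [pp Ip]; apply: cocyclic_mpow => m; apply/matrixP=> i j; rewrite !ord1 [RHS]mxE.
by rewrite -ev_monom -mulmxA -dual_flat_ext_smul ?Ip //; apply: is_poly_monom.
Qed.

Lemma agree_free tau' : (forall p, prodspan V V' p -> dual tau' p = sigma p) ->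
  himg_free (dual tau') U' w.
Proof.
move=> agree a a0; apply: wfree => u Uu; rewrite -[RHS](a0 u Uu).
by apply: eq_bigr => i _; rewrite agree //; apply: prodspan_mul (UV' Uu).
Qed.

(** The family [w] gives the lower bound. The upper bound holds because the Hankel operator factors
    through the rows [e p(M)] of length [r]. *)
Lemma flat_ext_rank : hrank (dual tau) is_poly is_poly r.
Proof.
split.
  exists w; split=> [i|]; first exact: polyV.
  move=> a a0; apply: (agree_free flat_ext_agree) => u /UV' /polyV'; exact: a0.
move=> p pp freep; pose C := \matrix_i (e *m ev M (p i)).
have [|a nza aC] := @row_dependence K _ _ C; first by rewrite ltnS rank_leq_col.
case/eqP: nza; apply/rowP=> i; rewrite mxE; apply: (freep (fun i => a 0 i)) => q pq.
transitivity ((a *m C *m (ev M q *m l)) 0 0); last by rewrite aC mul0mx mxE.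
rewrite (mulmx_sum_row a C) mulmx_suml summxE; apply: eq_bigr => k _.
by rewrite rowK dual_flat_ext_smul // -scalemxAl [RHS]mxE.
Qed.

(** * The kernel ideal and uniqueness *)

Local Notation N := (kerH sigma (vplus U) U').

(** Stated for every extension of rank [r], to serve both the ideal and uniqueness. Such a rank
    gives [g] coordinates on the [w_i] valid against all polynomials; testing on [U'] shows that
    they vanish. *)
Lemma kerH_Iker tau' : (forall p, prodspan V V' p -> dual tau' p = sigma p) ->
  hrank (dual tau') is_poly is_poly r -> forall g, N g -> Iker tau' g.
Proof.
move=> agree rk g [Ug kerg]; have Vg := plusU Ug; have pg := polyV Vg; split=> // q pq.
have U'poly : incl U' is_poly by move=> u /UV' /polyV'.
have [c cP] := hrank_coords rk (fun i => polyV (wV i)) U'poly (agree_free agree) pg.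
rewrite cP // big1 // => i _.
suff -> : c 0 i = 0 by rewrite mul0r.
apply: (agree_free agree (a := fun i => c 0 i)) => u Uu.
rewrite -cP; last exact: U'poly.
by rewrite agree; [apply: kerg | apply: prodspan_mul (UV' Uu)].
Qed.

Definition lift_row (a : 'rV[K]_r) : ser := fun m => \sum_i a 0 i * w i m.

Lemma lift_row_lin x a b :
  lift_row (x *: a + b) = (fun m => x * lift_row a m + lift_row b m).
Proof.
apply: functional_extensionality => m; rewrite /lift_row mulr_sumr -big_split /=.
by apply: eq_bigr => i _; rewrite !mxE mulrDl mulrA.
Qed.

Lemma vplus_kerH v : vplus U v -> N (fun m => -1 * lift_row (crd v) m + v m).
Proof.
move=> Uv; have Vv := plusU Uv; split.
  apply: (lspan_lin_closed _).2 => //; apply: lin_closed_sum => [|i].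
    exact: lspan_lin_closed.
  exact: vplus_sub.
move=> u Uu; have Vu := UV' Uu.
have wu i : prodspan V V' (smul u (w i)) by rewrite smulC; apply: prodspan_mul.
have vu : prodspan V V' (smul u v) by rewrite smulC; apply: prodspan_mul.
rewrite smulC smulDr smul_sumr linsig //; last exact: lin_closed_sum lin1 _.
rewrite (lin_on_sum _ lin1 linsig) // (smulC u v).
rewrite crd_sum // mulN1r addrC; apply/eqP; rewrite subr_eq0; apply/eqP.
by apply: eq_bigr => i _; rewrite (smulC u).
Qed.

Lemma rem_ideal p : is_poly p ->
  ideal_gen N (fun m => -1 * lift_row (e *m ev M p) m + p m).
Proof.
have [poly0 polyD] := is_poly_lin_closed K n.
have [id0 idD] := ideal_gen_lin_closed N.
have linid := ideal_gen_lin_closed N.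
pose rem p : ser := fun m => -1 * lift_row (e *m ev M p) m + p m.
pose Q p := is_poly p /\ ideal_gen N (rem p).
move=> pp; suff [//] : Q p; apply: (@is_poly_ind _ _ Q _ _ _ _ pp).
- split=> [|x f h [pf If] [ph Ih]].
    split=> //; suff -> : rem (fun=> 0) = (fun=> 0) by [].
    apply: functional_extensionality => m; rewrite /rem ev0 mulmx0 addr0.
    by rewrite /lift_row big1 ?mulr0 // => i _; rewrite mxE mul0r.
  split; first exact: polyD.
  suff -> : rem (fun m => x * f m + h m) = (fun m => x * rem f m + rem h m) by apply: idD.
  apply: functional_extensionality => m; rewrite /rem ev_lin // mulmxDr -scalemxAr.
  by rewrite lift_row_lin; ring.
- split=> //; apply: ideal_gen_gen; rewrite /rem ev1 mulmx1.
  by apply: vplus_kerH; apply: vplus_sub.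
move=> j f pf [_ If]; split; first exact: is_poly_smul.
pose c := e *m ev M f.
pose s i : ser := fun m => -1 * lift_row (crd (smul (X j) (w i))) m + smul (X j) (w i) m.
(* With [c] the coordinates of [f], the remainder of [x_j f] is [x_j] times the remainder of [f]
   plus the combination by [c] of the remainders of the [x_j w_i], which lie in [N] because
   [x_j w_i] is in [vplus U]. *)
suff -> : rem (smul (X j) f) = (fun m => 1 * smul (X j) (rem f) m + \sum_i c 0 i * s i m).
  apply: idD; first exact: ideal_gen_smul.
  apply: lin_closed_sum => // i; apply/ideal_gen_gen/vplus_kerH.
  exact: vplus_xvar.
have cM : e *m ev M (smul (X j) f) = c *m M j.
  rewrite ev_xvar //; last exact: mulop_comm.
  rewrite -mulmxA; congr (_ *m _).
  by apply: commr_ev => k; apply: mulop_comm.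
have liftM m : lift_row (c *m M j) m = \sum_i c 0 i * lift_row (crd (smul (X j) (w i))) m.
  rewrite /lift_row; under [RHS]eq_bigr do rewrite mulr_sumr.
  rewrite exchange_big /=; apply: eq_bigr => k _; rewrite mxE mulr_suml.
  by apply: eq_bigr => i _; rewrite [M j i k]mxE mulrA.
apply: functional_extensionality => m; rewrite /rem smulDr cM.
have -> : \sum_i c 0 i * s i m =
    -1 * lift_row (c *m M j) m + smul (X j) (lift_row c) m.
  rewrite liftM smul_sumr mulr_sumr -big_split /=; apply: eq_bigr => i _.
  by rewrite /s; ring.
by rewrite -/c; ring.
Qed.

Lemma Iker_flat_ext p : Iker tau p <-> ideal_gen N p.
Proof.
split=> [Ip|].
  have lift0 : lift_row 0 = (fun=> 0).
    by apply: functional_extensionality => m; apply: big1 => i _; rewrite mxE mul0r.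
  have := rem_ideal Ip.1; rewrite (Iker_ev Ip) lift0.
  suff -> : (fun m => -1 * (fun=> 0) m + p m) = p by [].
  by apply: functional_extensionality => m; rewrite mulr0 add0r.
apply: Iker_ideal => [g [/plusU /polyV] //|].
exact: kerH_Iker flat_ext_agree flat_ext_rank.
Qed.

(** An extension of rank [r] vanishes on the ideal generated by [N], hence takes the same value on
    [p] and on its representative in the span of the [w_i], where it is [sigma]. The right side does
    not involve [tau']. *)
Lemma agree_dual tau' : (forall p, prodspan V V' p -> dual tau' p = sigma p) ->
  hrank (dual tau') is_poly is_poly r ->
  forall p, is_poly p -> dual tau' p = sigma (lift_row (e *m ev M p)).
Proof.
move=> agree rk p pp; set f := lift_row _.
have wspan i : prodspan V V' (w i).
  by rewrite -(smul1r (w i)) smulC; apply: prodspan_mul => //; apply: connected_pone.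
have spanf : prodspan V V' f by apply: lin_closed_sum lin1 _.
have polyf : is_poly f by apply: prodspan_poly spanf.
rewrite -agree //; apply/eqP; rewrite -subr_eq0 addrC -mulN1r -dual_lin //.
have polyN : incl N is_poly by move=> g [/plusU /polyV].
have [_ I0] := Iker_ideal polyN (kerH_Iker agree rk) (rem_ideal pp).
by rewrite -[X in dual _ X]smul1r smulC I0.
Qed.

Lemma flat_ext_uniq tau' : (forall p, prodspan V V' p -> dual tau' p = sigma p) ->
  hrank (dual tau') is_poly is_poly r -> tau' = tau.
Proof.
move=> agree rk; apply: functional_extensionality => a.
have poly_a := is_poly_monom K a.
(* A coefficient is recovered from the value on the monomial [x^a], which is [a!] times it, because
   [a!] is invertible in characteristic zero. *)
apply: (mulIf (mfact_neq0 a charK)); rewrite -!dual_monom.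
by rewrite (agree_dual agree rk) // (agree_dual flat_ext_agree flat_ext_rank).
Qed.

End FlatExtension.

Theorem theorem4 (K : closedFieldType) (n : nat) (charK : [pchar K] =i pred0)
    (V V' U U' : ser K n -> Prop) (sigma : ser K n -> K) (r : nat) :
  subspace V -> subspace V' -> connected V -> connected V' ->
  lin_on sigma (prodspan V V') ->
  subspace U -> subspace U' -> incl U V -> incl U' V' ->
  U (@pone K n) -> incl (vplus U) V -> incl (vplus U') V' ->
  hrank sigma V V' r -> hrank sigma U U' r ->
  exists tau : ser K n,
    [/\ (forall p, prodspan V V' p -> dual tau p = sigma p),
        hrank (dual tau) (@is_poly K n) (@is_poly K n) r,
        (forall tau' : ser K n,
            (forall p, prodspan V V' p -> dual tau' p = sigma p) ->
            hrank (dual tau') (@is_poly K n) (@is_poly K n) r -> tau' = tau),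
        (exists (r' : nat) (om : 'I_r' -> ser K n) (xi : 'I_r' -> 'rV[K]_n)
                (mu : 'I_r' -> nat),
            [/\ (forall i, is_poly (om i)),
                tau = (fun m => \sum_(i < r') smul (om i) (expo (xi i)) m),
                (forall i, mu_eq (om i) (mu i))
              & r = (\sum_(i < r') mu i)%N])
      & (forall p, Iker tau p <-> ideal_gen (kerH sigma (vplus U) U') p)].
Proof.
move=> subV subV' conV conV' linsig _ _ UV UV' U1 plusU plusU' rkV [[w [wU wfree]] _].
(* Membership in [V] is placed after the existential, with the row 0 outside [V], so that choice
   yields a total function [crd]. *)
have coords v : exists c : 'rV[K]_r, V v -> forall v', V' v' ->
    sigma (smul v v') = \sum_i c 0 i * sigma (smul (w i) v').
  have [Vv|nVv] := classic (V v); last by exists 0.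
  by have [c cP] := hrank_coords rkV (fun i => UV _ (wU i)) UV' wfree Vv; exists c.
pose crd v := proj1_sig (constructive_indefinite_description _ (coords v)).
have crdP v v' : V v -> V' v' ->
    sigma (smul v v') = \sum_i crd v 0 i * sigma (smul (w i) v').
  by move=> Vv; apply: (proj2_sig (constructive_indefinite_description _ (coords v))).
exists (flat_ext sigma w crd); split.
- by move=> p; apply: (flat_ext_agree charK subV subV' conV conV' linsig UV UV'
    U1 plusU plusU' wU wfree crdP).
- exact: (flat_ext_rank charK subV subV' conV conV' linsig UV UV' U1 plusU plusU'
    wU wfree crdP).
- by move=> tau'; apply: (flat_ext_uniq charK subV subV' conV conV' linsig UV UV' U1
    plusU plusU' wU wfree crdP).
- apply: moment_decomposition => //.
  + exact: (mulop_comm UV' plusU plusU' wU wfree crdP).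
  + exact: (cyclic_ev subV conV linsig UV UV' U1 plusU plusU' wU wfree crdP).
  + by move=> u; apply: (cocyclic_mpow conV' linsig UV UV' plusU plusU' wU wfree crdP).
exact: (Iker_flat_ext charK subV subV' conV conV' linsig UV UV' U1 plusU plusU'
  wU wfree crdP).
Qed.
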